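(* Let $H$ be a separable infinite-dimensional complex Hilbert space. The unitary operators $T$ on $H$ whose weak limit semigroup $\mathcal{L}_T$ contains all operators of the form $\sum_{n=-\infty}^{\infty}a_nT^n$ with $(a_n)_{n\in\mathbb{Z}}\subseteq\mathbb{C}$ satisfying $\sum_{n=-\infty}^\infty|a_n|\le1$ form a dense $G_\delta$ set in $(\mathcal{U},\mathrm{SOT}^* )$ and in $(\mathcal{I},\mathrm{SOT})$, and a comeager set in $(\mathcal{C},\mathrm{WOT})$.
   Context: $\mathcal{C}$, $\mathcal{I}$, $\mathcal{U}$ denote the sets of contractions, (linear) isometries and unitary operators on $H$. WOT and SOT are the weak and strong operator topologies; $\mathrm{SOT}^*$ is the topology in which $T_\alpha\to T$ iff $T_\alpha\to T$ and $T_\alpha^*\to T^*$ strongly. A set is comeager if it contains a dense $G_\delta$ set. $\mathcal{L}_T$ is the set of operators $S$ such that $T^{n_k}\to S$ in the weak operator topology for some strictly increasing sequence $(n_k)$ in $\mathbb{N}$. *)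

(* Defs.v *)
From HB Require Import structures.
From mathcomp Require Import all_boot all_order all_algebra.
From mathcomp Require Import all_classical all_reals all_analysis.
From mathcomp Require Import borel_hierarchy complex.

Set Implicit Arguments.
Unset Strict Implicit.
Unset Printing Implicit Defensive.

Import Order.TTheory GRing.Theory Num.Theory.
Import numFieldNormedType.Exports.

Local Open Scope classical_set_scope.
Local Open Scope ring_scope.

(* [inner] is linear in its first argument, conjugate-linear in the second. *)
HB.mixin Record CompleteNormedModule_isHilbert (R : realType) H
    & @CompleteNormedModule R[i] H := {
  inner : {dot H for (@Num.conj R[i])} ;
  innerxx : forall x : H, inner x x = `|x| ^+ 2
}.

#[short(type="hilbertType")]
HB.structure Definition Hilbert (R : realType) :=
  {H of @CompleteNormedModule R[i] H & CompleteNormedModule_isHilbert R H}.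

Definition separable (T : topologicalType) : Prop :=
  exists2 D : set T, countable D & dense D.

Definition infinite_dimensional (K : fieldType) (V : lmodType K) : Prop :=
  ~ exists n (b : 'I_n -> V),
      forall x, exists c : 'I_n -> K, x = \sum_(i < n) c i *: b i.

(* Here [A] stands for the space [set_type A] with the topology induced by [X];
   the library's [subspace A] would not do, as it makes every point of [X]
   outside [A] isolated. *)
Definition dense_Gdelta_in (X : topologicalType) (A E : set X) : Prop :=
  [/\ E `<=` A,
      dense (set_val @^-1` E : set (set_type A)) &
      Gdelta (set_val @^-1` E : set (set_type A))].

Definition comeager_in (X : topologicalType) (A E : set X) : Prop :=
  E `<=` A /\ exists2 F : set X, F `<=` E & dense_Gdelta_in A F.

Definition bounded_operators (R : realType) (H : hilbertType R) :
    set (H -> H) :=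
  [set T | linear T /\ continuous T].

Definition bop (R : realType) (H : hilbertType R) : Type :=
  set_type (@bounded_operators R H).

Definition fun_of_bop (R : realType) (H : hilbertType R) (T : bop H) : H -> H :=
  set_val T.
Coercion fun_of_bop : bop >-> Funclass.

Section Operators.
Context {R : realType} (H : hilbertType R).
Implicit Types (T S : bop H) (A : set (bop H)).

Lemma iter_bounded T (n : nat) : iter n T \in @bounded_operators R H.
Proof.
have [linT contT] : bounded_operators (T : H -> H) by exact: set_valP.
rewrite inE; split.
  by elim: n => [//|n IHn] a x y /=; rewrite IHn linT.
elim: n => [|n IHn] x /=; first exact: cvg_id.
exact: (@continuous_comp _ _ _ (iter n T) T x (IHn x) (contT _)).
Qed.

Definition bop_pow T (n : nat) : bop H :=
  exist (fun f => f \in @bounded_operators R H) (iter n T) (iter_bounded T n).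

(* The default values of [xget] are never used: the adjoint of a bounded
   operator exists by the Riesz representation theorem, and inverses are only
   taken of unitary operators. *)
Definition adjoint T : H -> H :=
  xget (fun=> 0) [set S : H -> H | forall x y, inner (T x) y = inner x (S y)].

Definition inverse T : H -> H :=
  xget (fun=> 0) [set S : H -> H | cancel T S /\ cancel S T].

Definition powz T (n : int) : H -> H :=
  match n with
  | Posz k => iter k T
  | Negz k => iter k.+1 (inverse T)
  end.

Definition contractions : set (bop H) := [set T | forall x, `|T x| <= `|x|].

Definition isometries : set (bop H) := [set T | forall x, `|T x| = `|x|].

Definition unitaries : set (bop H) :=
  [set T | adjoint T \o T = id /\ T \o adjoint T = id].

Definition WOT : topologicalType :=
  initial_topology (fun T : bop H =>
    (fun xy => inner (T xy.1) xy.2) : {ptws (H * H)%type -> R[i]^o}).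

Definition SOT : topologicalType :=
  initial_topology (fun T : bop H => fun_of_bop T : {ptws H -> H}).

Definition SOTstar : topologicalType :=
  initial_topology (fun T : bop H =>
    ((fun_of_bop T, adjoint T) : ({ptws H -> H} * {ptws H -> H})%type)).

Definition weak_limits T : set (bop H) :=
  [set S | exists2 k : nat -> nat, {homo k : m n / (m < n)%N} &
    (fun j => bop_pow T (k j) : WOT) @ \oo --> (S : WOT)].

Definition laurent_partial_sum (a : int -> R[i]) T (N : nat) : H -> H :=
  fun x => \sum_(i < N.*2.+1) a (i%:Z - N%:Z) *: powz T (i%:Z - N%:Z) x.

(* The sum over all integers [n] of [a n *: T ^ n] is the limit in operator
   norm, i.e. uniformly on the unit ball, of the sums over [-N <= n <= N]; it is
   only used for absolutely summable [a], for which the order of summation does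
   not matter. *)
Definition is_laurent_sum (a : int -> R[i]) T S : Prop :=
  {uniform [set x : H | `|x| <= 1],
    laurent_partial_sum a T @ \oo --> fun_of_bop S}.

Definition laurent_contractions T : set (bop H) :=
  [set S | exists2 a : int -> R[i],
    (\esum_(n in [set: int]) (Normc.normc (a n))%:E <= 1)%E &
    is_laurent_sum a T S].

Definition universal_unitaries : set (bop H) :=
  [set T | unitaries T /\ laurent_contractions T `<=` weak_limits T].

End Operators.

Arguments contractions {R} H _.
Arguments isometries {R} H _.
Arguments unitaries {R} H _.
Arguments universal_unitaries {R} H _.

(* Main.v *)
(* On contractions, weak and strong neighbourhoods of an isometry coincide, so the
   universal unitaries can be described by countably many weakly open
   conditions: T is isometric, T has dense range, and for every Laurent
   polynomial p with Gaussian rational coefficients of total modulus at most 1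
   some large power of T is weakly close to p(T) on finitely many vectors. This
   yields the G_delta property for all three topologies at once.

   For the density, isometries form a Baire space in the strong topology, so one
   condition can be treated at a time. On a given finite-dimensional subspace an
   isometry agrees with a unitary differing from the identity by a finite rank
   operator, hence diagonal there, with eigenvectors f_i and eigenvalues la_i.
   As |p(la_i)| <= 1, p(la_i) = (u_i + v_i) / 2 with |u_i| = |v_i| = 1. Split f_i
   as (g_i + h_i) / sqrt 2 with g_i, h_i orthonormal and let T have eigenvalues
   near la_i on g_i and h_i, whose 2^k-th powers are u_i and v_i: then T^(2^k)
   has the same matrix coefficients on the f_i as p of the original unitary.
   Finally, on a finite-dimensional subspace every contraction is the
   compression of such a unitary, by the Halmos dilation. *)

Require Import Defs.
From mathcomp Require Import all_boot all_order all_algebra.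
From mathcomp Require Import all_classical all_reals all_analysis.
From mathcomp Require Import borel_hierarchy complex.
From mathcomp Require Import ring lra zify.

Set Implicit Arguments.
Unset Strict Implicit.
Unset Printing Implicit Defensive.

Import Order.TTheory GRing.Theory Num.Theory.
Import numFieldNormedType.Exports.

Local Open Scope classical_set_scope.
Local Open Scope ring_scope.

Section hilbert_space.
Context {R : realType} {H : hilbertType R}.
Local Notation C := R[i].
Implicit Types (x y z : H) (T : bop H).

(** * Inner products and bounded operators *)

Lemma innerC x y : inner x y = (inner y x)^*%R.
Proof. by rewrite hermC /= expr0 mul1r. Qed.

Lemma innerDl x y z : inner (x + y) z = inner x z + inner y z.
Proof. exact: linearDl. Qed.

Lemma innerDr x y z : inner z (x + y) = inner z x + inner z y.
Proof. exact: linearDr. Qed.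

Lemma innerBl x y z : inner (x - y) z = inner x z - inner y z.
Proof. exact: linearBl. Qed.

Lemma innerBr x y z : inner z (x - y) = inner z x - inner z y.
Proof. exact: linearBr. Qed.

Lemma innerZl (a : C) x y : inner (a *: x) y = a * inner x y.
Proof. exact: linearZl_LR. Qed.

Lemma innerZr (a : C) x y : inner x (a *: y) = a^* * inner x y.
Proof. by rewrite linearZr_LR. Qed.

Lemma inner0r x : inner x 0 = 0.
Proof. exact: linear0r. Qed.

Lemma inner_suml (I : finType) (f : I -> H) y :
  inner (\sum_i f i) y = \sum_i inner (f i) y.
Proof. exact: linear_sumlz. Qed.

Lemma inner_sumr (I : finType) (f : I -> H) y :
  inner y (\sum_i f i) = \sum_i inner y (f i).
Proof. exact: linear_sumr. Qed.

Lemma norm_sub_proj x y : `|y| = 1 ->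
  `|x - inner x y *: y| ^+ 2 = `|x| ^+ 2 - `|inner x y| ^+ 2.
Proof.
move=> y1; rewrite -!innerxx !(innerBl, innerBr, innerZl, innerZr).
rewrite (innerxx y) y1 expr1n.
rewrite (innerC y x) (normCK (inner x y)); ring.
Qed.

(** Cauchy-Schwarz: after normalising y, the squared distance from x to its projection on the line
    of y is nonnegative. *)
Lemma inner_le_norm x y : `|inner x y| <= `|x| * `|y|.
Proof.
have [->|y0] := eqVneq y 0; first by rewrite inner0r !normr0 mulr0.
pose z := `|y|^-1 *: y.
have z1 : `|z| = 1 by rewrite normrZ normfV normr_id mulVf ?normr_eq0.
have yE : y = `|y| *: z by rewrite scalerA mulfV ?normr_eq0// scale1r.
have zx : `|inner x z| <= `|x|.
  rewrite -(@ler_pXn2r _ 2) ?nnegrE//.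
  by rewrite -subr_ge0 -norm_sub_proj// exprn_ge0.
rewrite {1}yE innerZr normrM conj_Creal ?normr_real// normr_id mulrC.
by rewrite ler_wpM2r.
Qed.

Lemma inner_eq0 x : (forall y, inner x y = 0) -> x = 0.
Proof.
by move=> /(_ x) /eqP; rewrite innerxx expf_eq0 /= normr_eq0 => /eqP.
Qed.

Lemma norm_diff_sq x y :
  `|x - y| ^+ 2 = `|x| ^+ 2 + `|y| ^+ 2 - (inner x y + inner y x).
Proof. by rewrite -!innerxx !(innerBl, innerBr); ring. Qed.

Lemma bopD T x y : T (x + y) = T x + T y.
Proof. by have [linT _] := set_valP T; have := linT 1 x y; rewrite !scale1r. Qed.

Lemma bop0 T : T 0 = 0.
Proof. by apply: (addIr (T 0)); rewrite -bopD !add0r. Qed.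

Lemma bopZ T (a : C) x : T (a *: x) = a *: T x.
Proof.
have [linT _] := set_valP T; have := linT a x 0.
by rewrite -[\val T 0]/(T 0) bop0 !addr0.
Qed.

Lemma bopN T x : T (- x) = - T x.
Proof. by rewrite -scaleN1r bopZ scaleN1r. Qed.

Lemma bopB T x y : T (x - y) = T x - T y.
Proof. by rewrite bopD bopN. Qed.

Lemma bop_sum T (I : finType) (f : I -> H) : T (\sum_i f i) = \sum_i T (f i).
Proof. by apply: (big_morph (fun_of_bop T)); [exact: bopD|exact: bop0]. Qed.

Lemma bop_continuous T : continuous (T : H -> H).
Proof. by have [] := set_valP T. Qed.

(** * Convergence in the three operator topologies *)

Lemma initial_cvgP (S : choiceType) (X : topologicalType) (f : S -> X)
    (F : set_system S) (s : S) : Filter F ->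
  F --> (s : initial_topology f) <-> f @ F --> f s.
Proof.
move=> FF; split=> [Fs|Ffs].
  by apply: (cvg_trans (cvg_app f Fs)); exact: initial_continuous.
move=> A /= [_ [[B Bop <-] Bfs sBfA]].
by apply: filterS sBfA _; apply: Ffs; apply: open_nbhs_nbhs.
Qed.

Lemma cvg_innerl (X : Type) (F : set_system X) (FF : Filter F) (f : X -> H) x y :
  f @ F --> x -> inner (f t) y @[t --> F] --> (inner x y : C^o).
Proof.
move=> fx; apply/cvgrPdist_lt => e e0.
near=> t; rewrite -innerBl; apply: le_lt_trans (inner_le_norm _ _) _.
have y1 : 0 < `|y| + 1 by rewrite ltr_wpDl.
rewrite (@le_lt_trans _ _ (`|x - f t| * (`|y| + 1)))//.
  by rewrite ler_wpM2l// lerDl.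
rewrite -ltr_pdivlMr//; near: t.
by apply: cvgr_dist_lt => //; rewrite divr_gt0.
Unshelve. all: by end_near. Qed.

Lemma cvg_innerr (X : Type) (F : set_system X) (FF : Filter F) (f : X -> H) x y :
  f @ F --> x -> inner y (f t) @[t --> F] --> (inner y x : C^o).
Proof.
move=> fx; apply/cvgrPdist_lt => e e0.
near=> t; rewrite -innerBr innerC norm_conjC innerBl; near: t.
by apply: (@cvgr_dist_lt _ C^o); first exact: cvg_innerl.
Unshelve. all: by end_near. Qed.

Lemma cvg_WOTP (F : set_system (bop H)) (FF : Filter F) T0 :
  F --> (T0 : WOT H) <->
  forall x y, inner ((T : bop H) x) y @[T --> F] --> (inner (T0 x) y : C^o).
Proof.
split=> [/initial_cvgP|FT].
  move=> /pointwise_cvgP FT x y; exact: (FT (x, y)).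
apply/initial_cvgP; apply/pointwise_cvgP => -[x y]; exact: FT.
Qed.

Lemma cvg_SOTP (F : set_system (bop H)) (FF : Filter F) T0 :
  F --> (T0 : SOT H) <-> forall x, (T : bop H) x @[T --> F] --> T0 x.
Proof.
split=> [/initial_cvgP|FT].
  by move=> /pointwise_cvgP.
by apply/initial_cvgP; apply/pointwise_cvgP.
Qed.

Lemma cvg_SOTstarP (F : set_system (bop H)) (FF : Filter F) T0 :
  F --> (T0 : SOTstar H) <->
  (forall x, (T : bop H) x @[T --> F] --> T0 x) /\
  (forall x, adjoint (T : bop H) x @[T --> F] --> adjoint T0 x).
Proof.
split=> [/initial_cvgP FT|[FT FA]].
  have F1 : @fun_of_bop R H @ F --> (fun_of_bop T0 : {ptws H -> H}).
    exact: (cvg_comp _ _ FT cvg_fst).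
  have F2 : @adjoint R H @ F --> (adjoint T0 : {ptws H -> H}).
    exact: (cvg_comp _ _ FT cvg_snd).
  by split; [move/pointwise_cvgP: F1|move/pointwise_cvgP: F2].
have F1 : @fun_of_bop R H @ F --> (fun_of_bop T0 : {ptws H -> H}).
  by apply/pointwise_cvgP.
have F2 : @adjoint R H @ F --> (adjoint T0 : {ptws H -> H}).
  by apply/pointwise_cvgP.
apply/initial_cvgP => A [[B1 B2] /= [b1 b2] sA].
have G1 : F [set T : bop H | B1 (T : H -> H)] := F1 _ b1.
have G2 : F [set T : bop H | B2 (adjoint T)] := F2 _ b2.
apply: (@filterS _ F _ _ _ _ (filterI G1 G2)) => T [t1 t2].
exact: (sA (_, _)).
Qed.

Lemma bounded_operatorsP (f : H -> H) (M : C) :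
  linear f -> (forall x, `|f x| <= M * `|x|) -> f \in @bounded_operators R H.
Proof.
move=> linf fM; rewrite inE; split=> // x.
have linB (a b : H) : f a - f b = f (a - b).
  by rewrite [a - b]addrC -[- b]scaleN1r linf scaleN1r addrC.
(* In the trivial space M may be any complex number; |M| + 1 is a positive bound in every case. *)
have M0 : 0 < `|M| + 1 by rewrite ltr_wpDl.
apply/cvgrPdist_lt => e e0; near=> t.
rewrite (linB x t).
apply: le_lt_trans (fM _) _; apply: (@le_lt_trans _ _ ((`|M| + 1) * `|x - t|)).
  have [->|xt] := eqVneq (`|x - t|) 0; first by rewrite !mulr0.
  rewrite ler_pM2r ?lt_def ?xt//=.
  have := fM (x - t); rewrite -ler_pdivrMr ?lt_def ?xt//= => fMx.
  have M1 : 0 <= M by apply: le_trans fMx; rewrite divr_ge0.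
  by rewrite ger0_norm// lerDl.
rewrite mulrC -ltr_pdivlMr//; near: t; apply: cvgr_dist_lt; first exact: cvg_id.
by rewrite divr_gt0.
Unshelve. all: by end_near. Qed.

Definition mkbop (f : H -> H) (fb : f \in @bounded_operators R H) : bop H :=
  exist (fun f => f \in @bounded_operators R H) f fb.

(** * Contractions, isometries and unitaries *)

Lemma isometries_contractions : isometries H `<=` contractions H.
Proof. by move=> T isoT x; rewrite isoT. Qed.

(** Polarization: x - y yields the real part of the inner product, and replacing y by iy yields the
    imaginary part. *)
Lemma isometry_inner T : isometries H T -> forall x y, inner (T x) (T y) = inner x y.
Proof.
move=> isoT x y.
have re z : inner (T x) (T z) + inner (T z) (T x) = inner x z + inner z x.
  have := isoT (x - z); move=> /(congr1 (fun r => r ^+ 2)).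
  by rewrite bopB !norm_diff_sq !isoT => /addrI /oppr_inj.
have := re y; have := re ('i *: y).
rewrite bopZ !innerZr !innerZl conjCi !mulNr ![- _ + _]addrC -!mulrBr.
move=> /(mulfI (neq0Ci _)) im r.
have half (a b : C) : a = (a + b - (b - a)) / 2 by field.
by rewrite [LHS](half _ (inner (T y) (T x))) r im -half.
Qed.

Lemma contraction_iter T n x : contractions H T -> `|iter n T x| <= `|x|.
Proof. by move=> cT; elim: n => //= n; apply: le_trans; exact: cT. Qed.

Lemma iter_isometry T n x : isometries H T -> `|iter n T x| = `|x|.
Proof. by move=> iT; elim: n => //= n <-; exact: iT. Qed.

(** An adjoint is unique, so the function selected by [xget] has to be S. *)
Lemma adjointE T (S : H -> H) :
  (forall x y, inner (T x) y = inner x (S y)) -> adjoint T = S.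
Proof.
move=> TS; apply/funext => y.
have /xgetPex - /(_ (fun=> 0)) A : exists S : H -> H,
    [set S : H -> H | forall x y, inner (T x) y = inner x (S y)] S by exists S.
apply/eqP; rewrite -subr_eq0; apply/eqP/inner_eq0 => z.
by rewrite innerC innerBr -TS -A subrr conjC0.
Qed.

Lemma inverseE T (S : H -> H) : cancel T S -> cancel S T -> inverse T = S.
Proof.
move=> TS ST; apply/funext => y.
have /xgetPex - /(_ (fun=> 0)) [A1 A2] : exists S : H -> H,
    [set S : H -> H | cancel T S /\ cancel S T] S by exists S.
by rewrite -[y in LHS]ST; exact: A1.
Qed.

Lemma unitaries_isometries : unitaries H `<=` isometries H.
Proof.
move=> T [AT TA] x.
have [/xgetPex - /(_ (fun=> 0)) A|nA] := pselect (exists S : H -> H,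
  [set S : H -> H | forall x y, inner (T x) y = inner x (S y)] S).
  apply/eqP; rewrite -(@eqrXn2 _ 2)// -!innerxx; apply/eqP.
  by rewrite A -[xget _ _]/(adjoint T) -[adjoint T (T x)]/((adjoint T \o T) x) AT.
(* If T had no adjoint, [adjoint T] would be the default 0, and its being a left inverse of T would
   make H trivial. This spares the Riesz representation theorem. *)
have x0 (z : H) : z = 0.
  have := congr1 (@^~ z) AT; rewrite /adjoint xgetPN //=.
  by move=> S' hS'; apply: nA; exists S'.
by rewrite (x0 (T x)) (x0 x).
Qed.

Lemma surjective_isometry_inverse T : isometries H T ->
  (forall y, exists x, T x = y) -> exists S : H -> H, cancel T S /\ cancel S T.
Proof.
move=> iT sT; have [S TS] := choice sT; exists (S : H -> H); split=> // x.
by apply/eqP; rewrite -subr_eq0 -normr_eq0 -iT bopB TS subrr normr0.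
Qed.

Lemma adjoint_inverse T (S : H -> H) : isometries H T -> cancel S T -> adjoint T = S.
Proof.
by move=> iT ST; apply: adjointE => x y; rewrite -(isometry_inner iT x) ST.
Qed.

Lemma unitariesP T :
  unitaries H T <-> isometries H T /\ (forall y, exists x, T x = y).
Proof.
split=> [uT|[iT sT]].
  split; first exact: unitaries_isometries.
  by move=> y; exists (adjoint T y); have [_ /(congr1 (@^~ y))] := uT.
have [S [TS ST]] := surjective_isometry_inverse iT sT.
by split; rewrite (adjoint_inverse iT ST); apply/funext.
Qed.

(* The matrix coefficient of T^n, with T^(-k) read as the adjoint of T^k: this
   makes sense, and is strongly continuous in T, on all contractions. *)
Definition zform T (n : int) x y : C :=
  match n with
  | Posz k => inner (iter k T x) y
  | Negz k => inner x (iter k.+1 T y)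
  end.

Definition laurent_form (c : nat -> C) (N : nat) T x y : C :=
  \sum_(i < N.*2.+1) c i * zform T (i%:Z - N%:Z) x y.

Lemma zform_powz T (S : H -> H) n x y : isometries H T -> cancel T S -> cancel S T ->
  zform T n x y = inner (powz T n x) y.
Proof.
move=> iT TS ST; case: n => //= k; rewrite (inverseE TS ST) -!iterS.
elim: k.+1 x y => // n IHn x y; rewrite [iter n.+1 S x]iterSr -IHn.
by rewrite iterS -(isometry_inner iT (S x)) ST.
Qed.

Section convergence.
Variables (X : Type) (F : set_system X) (FF : Filter F) (U : X -> bop H) (T0 : bop H).
Hypothesis U_contraction : \forall t \near F, contractions H (U t).
Hypothesis U_cvg : forall x, U t x @[t --> F] --> T0 x.

(** Composition is jointly strongly continuous on norm bounded sets; contractivity of U t controls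
    the term where U t is applied to a varying vector. *)
Lemma cvg_iter n x : iter n (U t) x @[t --> F] --> iter n T0 x.
Proof.
elim: n => [|n IHn] /=; first exact: cvg_cst.
apply/cvgrPdist_lt => e e0; near=> t.
rewrite -[X in X < _]/(`|T0 (iter n T0 x) - U t (iter n (U t) x)|).
have -> : T0 (iter n T0 x) - U t (iter n (U t) x) =
    (T0 (iter n T0 x) - U t (iter n T0 x)) + U t (iter n T0 x - iter n (U t) x).
  by rewrite bopB addrA subrK.
apply: le_lt_trans (ler_normD _ _) _; rewrite [e]splitr ltrD//.
  by near: t; apply: cvgr_dist_lt; [exact: U_cvg|rewrite divr_gt0].
have cU : contractions H (U t) by near: t.
apply: le_lt_trans (cU _) _.
by near: t; apply: cvgr_dist_lt => //; rewrite divr_gt0.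
Unshelve. all: by end_near. Qed.

Lemma cvg_zform n x y : zform (U t) n x y @[t --> F] --> (zform T0 n x y : C^o).
Proof.
by case: n => k; [apply: cvg_innerl|apply: cvg_innerr]; exact: cvg_iter.
Qed.

End convergence.


Lemma cvg_sum_seq (V : normedModType C) (X I : Type) (F : set_system X)
    (FF : Filter F) (s : seq I) (f : I -> X -> V) (l : I -> V) :
  (forall i, f i t @[t --> F] --> l i) ->
  \sum_(i <- s) f i t @[t --> F] --> \sum_(i <- s) l i.
Proof.
move=> fl; elim: s => [|i s IHs].
  by rewrite big_nil; under eq_fun do rewrite big_nil; exact: cvg_cst.
by rewrite big_cons; under eq_fun do rewrite big_cons; exact: cvgD.
Qed.

Lemma cvg_laurent_form (X : Type) (F : set_system X) (FF : Filter F)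
    (U : X -> bop H) (T0 : bop H) c N x y :
  (\forall t \near F, contractions H (U t)) ->
  (forall x, U t x @[t --> F] --> T0 x) ->
  laurent_form c N (U t) x y @[t --> F] --> (laurent_form c N T0 x y : C^o).
Proof.
move=> cU UT; apply: (@cvg_sum_seq C^o) => i.
have h : zform (U t) (i%:Z - N%:Z) x y @[t --> F] -->
    (zform T0 (i%:Z - N%:Z) x y : C^o) by exact: cvg_zform.
exact: (@cvgZl_tmp C C^o _ _ _ (c i) _ _ h).
Qed.

(** This is the closedness of the isometries under pointwise limits, which makes the limit in the
    Baire argument an operator. *)
Lemma cvg_norm_isometry (X : Type) (F : set_system X) (FF : ProperFilter F)
    (U : X -> bop H) (f : H -> H) :
  (\forall t \near F, isometries H (U t)) ->
  (forall x, U t x @[t --> F] --> f x) ->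
  f \in @bounded_operators R H /\ forall x, `|f x| = `|x|.
Proof.
move=> iU Uf.
have nf x : `|f x| = `|x|.
  have h1 : `|U t x| @[t --> F] --> (`|f x| : C^o) by exact: cvg_norm.
  have h2 : `|U t x| @[t --> F] --> (`|x| : C^o).
    apply: cvg_near_cst; near=> t.
    by have iUt : isometries H (U t) by [near: t]; rewrite iUt.
  exact: (cvg_unique _ h1 h2).
split=> //; apply: (@bounded_operatorsP _ 1); last by move=> x; rewrite mul1r nf.
move=> a x y.
have h1 : U t (a *: x + y) @[t --> F] --> f (a *: x + y) by exact: Uf.
have h2 : U t (a *: x + y) @[t --> F] --> a *: f x + f y.
  under eq_fun do rewrite bopD bopZ.
  by apply: cvgD => //; apply: cvgZl_tmp.
exact: (cvg_unique _ h1 h2).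
Unshelve. all: by end_near. Qed.

(* For contractions T and an isometry T0,
   |T x - T0 x|^2 <= 2 |x|^2 - 2 Re <T x, T0 x>, so weak convergence to T0
   forces strong convergence. *)
Lemma strong_cvg_isometry T0 : isometries H T0 -> forall x,
  (T : bop H) x @[T --> within (contractions H) (nbhs (T0 : WOT H))] --> T0 x.
Proof.
move=> iT0 x.
have /cvg_WOTP W : nbhs (T0 : WOT H) --> (T0 : WOT H) by exact: cvg_id.
have /cvgrPdist_lt {}W := W x (T0 x).
apply/cvgrPdist_lt => e e0.
rewrite near_withinE; have e2 : 0 < e ^+ 2 / 2 by rewrite divr_gt0 ?exprn_gt0.
apply: filterS (W _ e2) => T /= WT cT.
rewrite -(@ltr_pXn2r _ 2) ?nnegrE ?normr_ge0 ?(ltW e0)//.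
set z := (X in `|X| < _) in WT.
apply: (@le_lt_trans _ _ (z + z^*)).
  rewrite norm_diff_sq /z -innerBl -innerC innerBr innerBl.
  rewrite !innerxx (iT0 x) -subr_ge0.
  have -> : `|x| ^+ 2 - inner (T x) (T0 x) + (`|x| ^+ 2 - inner (T0 x) (T x)) -
     (`|x| ^+ 2 + `|T x| ^+ 2 - (inner (T0 x) (T x) + inner (T x) (T0 x))) =
     `|x| ^+ 2 - `|T x| ^+ 2 by ring.
  by rewrite subr_ge0 ler_pXn2r ?nnegrE//; exact: cT.
have zr : z + z^* \is Num.real by rewrite CrealE rmorphD/= conjCK addrC.
apply: (le_lt_trans (real_ler_norm zr)); apply: (le_lt_trans (ler_normD _ _)).
by rewrite norm_conjC -mulr2n -mulr_natr -ltr_pdivlMr.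
Qed.

Lemma near_natSinv_lt (e : C) : 0 < e ->
  exists q : nat, forall n, (q <= n)%N -> n.+1%:R^-1 < e.
Proof.
move=> e0; have re : (complex.Re e)%:C%C = e by apply: RRe_real; exact: gtr0_real.
have e0' : 0 < complex.Re e by rewrite -ltcR re.
have [q _ qe] := near_infty_natSinv_lt (PosNum e0').
exists q => n qn; have := qe n qn; rewrite -ltcR /= re.
by rewrite fmorphV /= rmorph_nat.
Qed.

Lemma near_forall_ltn (X : Type) (F : set_system X) (FF : Filter F)
    (P : nat -> X -> Prop) (m : nat) :
  (forall i, (i < m)%N -> \forall t \near F, P i t) ->
  \forall t \near F, forall i, (i < m)%N -> P i t.
Proof.
elim: m => [_|m IHm Pm]; first by near=> t.
have h1 : \forall t \near F, forall i, (i < m)%N -> P i t.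
  by apply: IHm => i im; apply: Pm; exact: ltnW.
have h2 := Pm m (ltnSn m).
near=> t => i; rewrite ltnS leq_eqVlt => /predU1P[->|]; first by near: t.
by move: i; near: t.
Unshelve. all: by end_near. Qed.

Definition rat_complex (p : rat * rat) : C := Complex (ratr p.1) (ratr p.2).

Definition rat_coef (s : seq (rat * rat)) (i : nat) : C :=
  rat_complex (nth (0, 0) s i).

(** * Countably many conditions characterizing universality *)

Section countable_conditions.
Variable (D : nat -> H).
Hypothesis denseD : forall x (e : C), 0 < e -> exists i, `|x - D i| < e.

(** Required for all p, this means dense range, because D is dense; the range of an isometry is
    closed, so it is then the whole space. *)
Definition almost_onto (p : nat * nat) : set (bop H) :=
  [set T | exists y, `|D p.1 - T y| < p.2.+1%:R^-1].

(** The bound on the moduli is a premise, so that all finite rational sequences can serve as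
    indices. The number m bounds the vectors tested, the exponent from below, and the error. *)
Definition laurent_recurrent (p : nat * seq (rat * rat) * nat) : set (bop H) :=
  let: (N, s, m) := p in
  [set T | \sum_(i < N.*2.+1) `|rat_coef s i| <= 1 ->
    exists2 n, (m <= n)%N & forall i, (i < m)%N -> forall j, (j < m)%N ->
      `|laurent_form (rat_coef s) N T (D i) (D j) - inner (iter n T (D i)) (D j)|
        < m.+1%:R^-1].

Definition generic_condition (k : nat) : set (bop H) :=
  match unpickle k with
  | Some (inl p) => almost_onto p
  | Some (inr p) => laurent_recurrent p
  | None => setT
  end.

Lemma generic_conditionP T :
  (forall k, generic_condition k T) <->
  (forall p, almost_onto p T) /\ (forall p, laurent_recurrent p T).
Proof.
split=> [gT|[T1 T2] k].
  split=> p.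
    by have := gT (pickle (inl p : nat * nat + nat * seq (rat * rat) * nat));
      rewrite /generic_condition pickleK.
  by have := gT (pickle (inr p : nat * nat + nat * seq (rat * rat) * nat));
    rewrite /generic_condition pickleK.
by rewrite /generic_condition; case: unpickle => // -[p|p].
Qed.

(** For a fixed witness, y or n, a condition is a finite family of strict inequalities between
    quantities that are strongly continuous on contractions. *)
Lemma generic_condition_near (X : Type) (F : set_system X) (FF : Filter F)
    (U : X -> bop H) (T0 : bop H) k :
  (\forall t \near F, contractions H (U t)) ->
  (forall x, U t x @[t --> F] --> T0 x) ->
  generic_condition k T0 -> \forall t \near F, generic_condition k (U t).
Proof.
move=> cU UT; rewrite /generic_condition; case: unpickle; last first.
  by move=> _; near=> t.
case=> [[i q]|[[N s] m]] /=.
  move=> [y yT].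
  have e0 : 0 < q.+1%:R^-1 - `|D i - T0 y| by rewrite subr_gt0.
  near=> t; exists y.
  have -> : D i - U t y = (D i - T0 y) + (T0 y - U t y) by rewrite addrA subrK.
  apply: le_lt_trans (ler_normD _ _) _; rewrite -ltrBrDl; near: t.
  exact: cvgr_dist_lt (UT y) _ e0.
move=> WT.
have [s1|/negP s1] := boolP (\sum_(i < N.*2.+1) `|rat_coef s i| <= 1); last first.
  by near=> t.
have [n mn Wn] := WT s1.
suff : \forall t \near F, forall i, (i < m)%N -> forall j, (j < m)%N ->
    `|laurent_form (rat_coef s) N (U t) (D i) (D j) - inner (iter n (U t) (D i)) (D j)|
      < m.+1%:R^-1.
  by apply: filterS => t Ut _; exists n.
apply: near_forall_ltn => i im; apply: near_forall_ltn => j jm.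
pose z (T : bop H) :=
  laurent_form (rat_coef s) N T (D i) (D j) - inner (iter n T (D i)) (D j).
have zU : z (U t) @[t --> F] --> (z T0 : C^o).
  apply: (@cvgB _ C^o); first exact: cvg_laurent_form.
  by apply: cvg_innerl; exact: cvg_iter.
have e0 : 0 < m.+1%:R^-1 - `|z T0| by rewrite subr_gt0; exact: Wn.
have := @cvgr_distC_lt _ C^o _ _ FF _ _ zU _ e0.
apply: filterS => t zt.
rewrite -/(z (U t)) -[z (U t)](subrK (z T0)).
by apply: le_lt_trans (ler_normD _ _) _; rewrite -ltrBrDr.
Unshelve. all: by end_near. Qed.

(** The norm of T x is the supremum of |<T x, y>| over the unit ball; a strict lower bound in this
    form is weakly open. *)
Definition almost_isometric (p : nat * nat) : set (bop H) :=
  [set T | exists2 y, `|y| <= 1 & `|D p.1| - p.2.+1%:R^-1 < `|inner (T (D p.1)) y|].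

Lemma open_almost_isometric p : open (almost_isometric p : set (WOT H)).
Proof.
rewrite openE => T0 [y y1 Ty]; pose T : bop H := T0.
rewrite /interior -[nbhs T0]/(nbhs (T : WOT H)).
have /cvg_WOTP W : nbhs (T : WOT H) --> (T : WOT H) by exact: cvg_id.
have e0 : 0 < `|inner (T (D p.1)) y| - (`|D p.1| - p.2.+1%:R^-1) by rewrite subr_gt0.
have := @cvgr_dist_lt _ C^o _ _ (nbhs_filter _) _ _ (W (D p.1) y) _ e0.
apply: filterS => S /= Se.
exists y => //.
move: Se; rewrite ltrBrDl -ltrBrDr => /lt_le_trans; apply.
by rewrite lerBlDl -[X in `|X| <= _](subrK (inner ((S : bop H) (D p.1)) y)) ler_normD.
Qed.

Lemma isometriesP T :
  isometries H T <-> contractions H T /\ forall p, almost_isometric p T.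
Proof.
split=> [iT|[cT aT] x].
  split=> [|p]; first exact: isometries_contractions.
  (* If D p.1 = 0 the inverse norm is 0 and so is this vector; the inequality then holds because its
     left side is negative. *)
  exists (`|D p.1|^-1 *: T (D p.1)).
    rewrite normrZ normfV normr_id iT.
    by have [->|d0] := eqVneq (`|D p.1|) 0; rewrite ?mulr0 ?mulVf.
  rewrite innerZr conj_Creal ?rpredV ?normr_real// innerxx iT.
  have [->|d0] := eqVneq (`|D p.1|) 0.
    by rewrite invr0 mul0r normr0 sub0r oppr_lt0 invr_gt0 ltr0n.
  rewrite expr2 mulKf// normr_id ltrBlDr ltrDl invr_gt0 ltr0n//.
apply/eqP; rewrite eq_le cT /=; apply/ler_addgt0Pr => e e0.
have e4 : 0 < e / 4 by rewrite divr_gt0.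
have [i xi] := denseD x e4.
have [q /(_ q (leqnn q)) qe] := near_natSinv_lt e4.
have [y y1] := aT (i, q); rewrite /= ltrBlDr => aTi.
have h1 : `|x| <= `|x - D i| + `|D i| by rewrite -{1}[x](subrK (D i)) ler_normD.
have h2 : `|inner (T (D i)) y| <= `|T (D i)|.
  by apply: (le_trans (inner_le_norm _ _)); rewrite ler_piMr.
have h3 : `|T (D i)| <= `|T x| + `|x - D i|.
  rewrite -[D i in X in `|X|](subKr x) bopB; apply: (le_trans (ler_normB _ _)).
  by rewrite lerD2l; exact: cT.
apply: (le_trans h1); apply: (le_trans (lerD (ltW xi) (ltW aTi))).
have -> : `|T x| + e = e / 4 + (`|T x| + e / 4 + e / 4 + e / 4) by field.
rewrite lerD2l lerD ?(ltW qe)//; apply: (le_trans h2); apply: (le_trans h3).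
by rewrite -addrA lerD2l; apply: (le_trans (ltW xi)); rewrite lerDl ltW.
Qed.

(** * Laurent polynomials and Laurent series of a unitary operator *)

Lemma normcC (z : C) : `|z| = (Normc.normc z)%:C%C.
Proof. by []. Qed.

Lemma esum_window (a : int -> \bar R) (N : nat) : (forall n, 0 <= a n)%E ->
  (\esum_(j in (fun i : nat => (i%:Z - N%:Z)%R) @` `I_(N.*2.+1)) a j =
   \sum_(i < N.*2.+1) a (i%:Z - N%:Z)%R)%E.
Proof.
move=> a0; rewrite esum_image; last by move=> i j _ _ /addIr [].
by rewrite esum_fset// -fsbig_ord.
Qed.

Lemma sum_normcE (c : nat -> C) (k : nat) :
  (\sum_(i < k) (Normc.normc (c i))%:E <= 1)%E = (\sum_(i < k) `|c i| <= 1).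
Proof.
rewrite sumEFin lee_fin -lecR rmorph_sum /=.
by congr (_ <= _); apply: eq_bigr => i _; rewrite normcC.
Qed.

Lemma esum_window_le (a : int -> C) (N : nat) :
  (\esum_(n in [set: int]) (Normc.normc (a n))%:E <= 1)%E ->
  \sum_(i < N.*2.+1) `|a (i%:Z - N%:Z)| <= 1.
Proof.
move=> a1; rewrite -(sum_normcE (fun i => a (i%:Z - N%:Z))).
have a0 n : (0 <= (Normc.normc (a n))%:E)%E by rewrite lee_fin -ler0c -normcC.
rewrite -(esum_window N a0); apply: le_trans a1; rewrite esum_mkcond.
by apply: le_esum => n _; case: ifP.
Qed.

Definition finite_coef (c : nat -> C) (N : nat) (n : int) : C :=
  if n + N%:Z is Posz i then if (i < N.*2.+1)%N then c i else 0 else 0.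

Lemma finite_coefE c N i : (i < N.*2.+1)%N -> finite_coef c N (i%:Z - N%:Z) = c i.
Proof. by move=> iN; rewrite /finite_coef subrK iN. Qed.

Lemma finite_coef_out c N n :
  (forall i, (i < N.*2.+1)%N -> n <> i%:Z - N%:Z) -> finite_coef c N n = 0.
Proof.
rewrite /finite_coef; case E : (n + N%:Z) => [i|//] h; case: ifP => // iN.
by case: (h i iN); rewrite -E addrK.
Qed.

Lemma esum_finite_coef (c : nat -> C) N : \sum_(i < N.*2.+1) `|c i| <= 1 ->
  (\esum_(n in [set: int]) (Normc.normc (finite_coef c N n))%:E <= 1)%E.
Proof.
move=> c1; have a0 n : (0 <= (Normc.normc (finite_coef c N n))%:E)%E.
  by rewrite lee_fin -ler0c -normcC.
have := esum_window N a0; rewrite esum_mkcond.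
under [X in _ = X]eq_bigr => i _ do rewrite finite_coefE//.
move=> /esym E; have := sum_normcE c N.*2.+1; rewrite E c1 => /idP.
apply: le_trans; apply: le_esum => n _; case: ifPn => // nN.
rewrite finite_coef_out ?Normc.normc0// => i iN nE.
by move/negP: nN; apply; rewrite inE; exists i.
Qed.

Lemma window_sumS (V : nmodType) (g : int -> V) (N : nat) :
  \sum_(i < N.+1.*2.+1) g (i%:Z - N.+1%:Z) =
  g (- N.+1%:Z) + (\sum_(i < N.*2.+1) g (i%:Z - N%:Z) + g N.+1%:Z).
Proof.
rewrite doubleS big_ord_recl big_ord_recr /= sub0r; congr (_ + (_ + _)).
  by apply: eq_bigr => i _; congr g; rewrite /bump /= add1n; lia.
by congr g; rewrite /bump /=; lia.
Qed.

Lemma laurent_partial_sum_finite c N T N' x : (N <= N')%N ->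
  laurent_partial_sum (finite_coef c N) T N' x =
  \sum_(i < N.*2.+1) c i *: powz T (i%:Z - N%:Z) x.
Proof.
elim: N' => [|N' IHN]; rewrite leq_eqVlt => /predU1P[E|].
- by rewrite -E; apply: eq_bigr => i _; rewrite finite_coefE.
- by [].
- by rewrite -E; apply: eq_bigr => i _; rewrite finite_coefE.
rewrite ltnS => NN'; rewrite /laurent_partial_sum.
rewrite (window_sumS (fun n => finite_coef c N n *: powz T n x)).
rewrite -/(laurent_partial_sum (finite_coef c N) T N' x) IHN//.
rewrite !finite_coef_out ?scale0r ?addr0 ?add0r//.
  by move=> i iN; lia.
by move=> i iN; lia.
Qed.

Lemma surjective_isometry_inverse_bop T : isometries H T ->
  (forall y, exists x, T x = y) ->
  exists S : bop H, [/\ isometries H S, cancel T S & cancel S T].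
Proof.
move=> iT sT; have [S [TS ST]] := surjective_isometry_inverse iT sT.
have linS : linear S.
  by move=> a x y; apply: (can_inj TS); rewrite bopD bopZ !ST.
have iS x : `|S x| = `|x| by rewrite -iT ST.
have Sb : S \in @bounded_operators R H.
  by apply: (@bounded_operatorsP S 1) => // x; rewrite iS mul1r.
by exists (mkbop Sb); split.
Qed.

Lemma powz_bop T n : isometries H T -> (forall y, exists x, T x = y) ->
  exists2 P : bop H, isometries H P & forall x, powz T n x = P x.
Proof.
move=> iT sT; have [S [iS TS ST]] := surjective_isometry_inverse_bop iT sT.
case: n => k; first by exists (bop_pow T k) => // x; exact: iter_isometry.
exists (bop_pow S k.+1) => x; first exact: (iter_isometry k.+1).
by rewrite /powz (inverseE TS ST).
Qed.

(** All integer powers of a surjective isometry are isometries, so the sum of the moduli of the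
    coefficients bounds the norm of p(T). *)
Lemma laurent_bop (c : nat -> C) N T : isometries H T ->
  (forall y, exists x, T x = y) -> \sum_(i < N.*2.+1) `|c i| <= 1 ->
  exists2 P : bop H, contractions H P & forall x,
    P x = \sum_(i < N.*2.+1) c i *: powz T (i%:Z - N%:Z) x /\
    forall y, inner (P x) y = laurent_form c N T x y.
Proof.
move=> iT sT c1.
have /choice[Q /all_and2[iQ QE]] : forall n, exists P : bop H,
    isometries H P /\ forall x, powz T n x = P x.
  by move=> n; have [P] := powz_bop n iT sT; exists P.
pose f x := \sum_(i < N.*2.+1) c i *: Q (i%:Z - N%:Z) x.
have linf : linear f.
  move=> a x y; rewrite /f scaler_sumr -big_split /=; apply: eq_bigr => i _.
  by rewrite bopD bopZ scalerDr !scalerA mulrC.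
have cf x : `|f x| <= 1 * `|x|.
  apply: (le_trans (ler_norm_sum _ _ _)).
  under eq_bigr => i _ do rewrite normrZ iQ.
  by rewrite -mulr_suml ler_wpM2r.
exists (mkbop (bounded_operatorsP linf cf)) => x.
  by have := cf x; rewrite mul1r.
split; first by apply: eq_bigr => i _; rewrite QE.
move=> y; rewrite /= /f inner_suml; apply: eq_bigr => i _.
have [S [TS ST]] := surjective_isometry_inverse iT sT.
by rewrite innerZl (zform_powz _ _ _ iT TS ST) QE.
Qed.

(** Homogeneity turns uniform convergence on the unit ball into an estimate at every vector. *)
Lemma laurent_sumP a T (P : nat -> bop H) (S : bop H) :
  (forall N x, P N x = laurent_partial_sum a T N x) ->
  is_laurent_sum a T S <->
  forall e : C, 0 < e -> \forall N \near \oo, forall x, `|S x - P N x| <= e * `|x|.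
Proof.
move=> PE.
have unitball : is_laurent_sum a T S <-> forall e : C, 0 < e ->
    \forall N \near \oo, forall x, `|x| <= 1 -> `|S x - P N x| < e.
  split=> [W e e0|W].
    have Wn : \forall N \near \oo, forall x, `|x| <= 1 ->
        `|S x - laurent_partial_sum a T N x| < e.
      apply: (W [set h | forall x, `|x| <= 1 -> `|S x - h x| < e]).
      apply/uniform_nbhs; exists [set xy | `|xy.1 - xy.2| < e]; split=> //=.
      by rewrite -entourage_from_ballE; exists e => // -[u v] /=; rewrite -ball_normE.
    by apply: filterS Wn => N WN x x1; rewrite PE; exact: WN.
  move=> A /uniform_nbhs [E [+ EA]].
  rewrite -entourage_from_ballE => -[e /= e0 eE].
  rewrite /fmap /= nbhs_simpl; apply: filterS (W _ e0) => N WN.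
  by apply: EA => x x1; apply: eE; rewrite /= -ball_normE /= -PE; exact: WN.
split=> [/unitball W e e0|W].
  apply: filterS (W _ e0) => N WN x.
  have [->|x0] := eqVneq x 0; first by rewrite !bop0 subrr normr0 mulr0.
  have nx0 : 0 < `|x| by rewrite normr_gt0.
  have x1 : `| `|x|^-1 *: x| <= 1 by rewrite normrZ normfV normr_id mulVf ?gt_eqF.
  have /ltW := WN _ x1.
  by rewrite !bopZ -scalerBr normrZ normfV normr_id mulrC ler_pdivrMr.
(* Halving e restores the strict inequality. *)
apply/unitball => e e0; have e2 : 0 < e / 2 by rewrite divr_gt0.
apply: filterS (W _ e2) => N WN x x1; apply: (le_lt_trans (WN x)).
apply: (@le_lt_trans _ _ (e / 2)); first by rewrite ler_piMr// ltW.
by rewrite ltr_pdivrMr// ltr_pMr// ltr1n.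
Qed.

Lemma rat_complex_approx (z e : C) : 0 < e -> exists p, `|rat_complex p - z| < e.
Proof.
move=> e0; have re : (complex.Re e)%:C%C = e by apply: RRe_real; exact: gtr0_real.
have e0' : 0 < complex.Re e by rewrite -ltcR re.
have near_rat (x : R) : exists q : rat, `|ratr q - x| < complex.Re e / 2.
  have [q] := @rat_in_itvoo R (x - complex.Re e / 2) (x + complex.Re e / 2) ltac:(lra).
  by rewrite in_itv /= => /andP[q1 q2]; exists q; rewrite ltr_distl q1 q2.
case: z => a b; have [p pa] := near_rat a; have [q qb] := near_rat b.
exists (p, q); rewrite /rat_complex /=.
have -> : Complex (ratr p) (ratr q) - Complex a b =
    (ratr p - a)%:C%C + 'i%C * (ratr q - b)%:C%C :> C by rewrite [LHS]complexE.
apply: le_lt_trans (ler_normD _ _) _.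
rewrite normrM !normcC /= !expr0n /= !add0r !addr0 expr1n !sqrtr_sqr sqrtr1 mul1r.
by rewrite -rmorphD -re ltcR; lra.
Qed.

(** Rounding c itself could push the total modulus above 1, so c is first shrunk by the factor 1 -
    eta, which leaves room eta for the rounding. *)
Lemma rat_coef_approx (c : nat -> C) (k : nat) (e : C) : 0 < e ->
  \sum_(i < k) `|c i| <= 1 ->
  exists2 s, \sum_(i < k) `|rat_coef s i| <= 1 &
    \sum_(i < k) `|c i - rat_coef s i| <= e.
Proof.
move=> e0 c1.
have e20 : 0 < e + 2 by rewrite addr_gt0.
(* The rounding and the shrinking each cost eta, and this value satisfies 2 eta + eta e = e. *)
pose eta := e / (e + 2); have eta0 : 0 < eta by rewrite divr_gt0.
have eta1 : eta < 1 by rewrite ltr_pdivrMr// mul1r ltrDl.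
have k0 : 0 < eta / k.+1%:R by rewrite divr_gt0.
have /choice[p pP] : forall i, exists p,
    `|rat_complex p - (1 - eta) * c i| < eta / k.+1%:R.
  by move=> i; exact: rat_complex_approx.
pose s := mkseq p k.
have sE (i : 'I_k) : rat_coef s i = rat_complex (p i) by rewrite /rat_coef nth_mkseq.
have d1 : \sum_(i < k) `|rat_coef s i - (1 - eta) * c i| <= eta.
  apply: (@le_trans _ _ (\sum_(i < k) eta / k.+1%:R)).
    by apply: ler_sum => i _; rewrite sE ltW.
  rewrite sumr_const card_ord -[X in X <= _]mulr_natl mulrCA ler_piMr ?(ltW eta0)//.
  by rewrite ler_pdivrMr// mul1r ler_nat.
have d2 : \sum_(i < k) `|(1 - eta) * c i| <= 1 - eta.
  under eq_bigr => i _ do rewrite normrM.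
  rewrite -mulr_sumr ger0_norm ?subr_ge0 ?(ltW eta1)//.
  by rewrite ler_piMr// subr_ge0 ltW.
have d3 : \sum_(i < k) `|eta * c i| <= eta.
  under eq_bigr => i _ do rewrite normrM.
  by rewrite -mulr_sumr ger0_norm ?(ltW eta0)// ler_piMr// ltW.
exists s.
  have -> : 1 = eta + (1 - eta) :> C by rewrite addrC subrK.
  apply: le_trans (lerD d1 d2); rewrite -big_split /=; apply: ler_sum => i _.
  by rewrite -[X in `|X| <= _](subrK ((1 - eta) * c i)) ler_normD.
have -> : e = eta + eta + eta * e by rewrite /eta; field; rewrite gt_eqF.
apply: (@le_trans _ _ (eta + eta)); last by rewrite lerDl mulr_ge0 ?(ltW eta0) ?(ltW e0).
apply: le_trans (lerD d1 d3); rewrite -big_split /=; apply: ler_sum => i _.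
rewrite distrC (_ : _ - c i = (rat_coef s i - (1 - eta) * c i) - eta * c i).
  exact: ler_normB.
by ring.
Qed.

Lemma laurent_form_le (c : nat -> C) N T x y : isometries H T ->
  `|laurent_form c N T x y| <= (\sum_(i < N.*2.+1) `|c i|) * (`|x| * `|y|).
Proof.
move=> iT; rewrite mulr_suml; apply: (le_trans (ler_norm_sum _ _ _)).
apply: ler_sum => i _; rewrite normrM ler_wpM2l//.
case: (i%:Z - N%:Z) => n /=; apply: (le_trans (inner_le_norm _ _)).
  by rewrite (iter_isometry n).
by rewrite -iterS (iter_isometry n.+1).
Qed.

Lemma laurent_formB (c d : nat -> C) N T x y :
  laurent_form c N T x y - laurent_form d N T x y =
  laurent_form (fun i => c i - d i) N T x y.
Proof.
by rewrite /laurent_form -sumrB; apply: eq_bigr => i _; rewrite mulrBl.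
Qed.

(** The operator p(T) is itself a Laurent contraction, hence a weak limit of powers of T; finitely
    many of its matrix coefficients are then approximated by one large power. *)
Lemma universal_recurrent T p : universal_unitaries H T -> laurent_recurrent p T.
Proof.
case: p => [[N s] m] [/unitariesP[iT sT] uT] /= s1.
have [P cP PE] := laurent_bop iT sT s1.
have lP : laurent_contractions T P.
  exists (finite_coef (rat_coef s) N); first exact: esum_finite_coef.
  have /choice[Q QE] : forall M, exists Q : bop H,
      forall x, Q x = laurent_partial_sum (finite_coef (rat_coef s) N) T M x.
    move=> M; have := esum_window_le M (esum_finite_coef s1).
    move=> /(laurent_bop (c := fun i => finite_coef (rat_coef s) N (i%:Z - M%:Z)) iT sT).
    by move=> [Q _ QE]; exists Q => x; have [-> _] := QE x.
  apply/(laurent_sumP _ QE) => e e0; exists N => // M /= NM x.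
  rewrite QE laurent_partial_sum_finite//; have [-> _] := PE x.
  by rewrite subrr normr0 mulr_ge0// ltW.
have [k k_mono /cvg_WOTP kP] := uT _ lP.
have k_ge j : (j <= k j)%N.
  by elim: j => // j IHj; apply: (leq_ltn_trans IHj); exact: k_mono.
have m0 : 0 < m.+1%:R^-1 :> C by rewrite invr_gt0 ltr0n.
have : \forall n \near \oo, forall i, (i < m)%N -> forall j, (j < m)%N ->
    `|inner (P (D i)) (D j) - inner (bop_pow T (k n) (D i)) (D j)| < m.+1%:R^-1.
  apply: near_forall_ltn => i _; apply: near_forall_ltn => j _.
  exact: (@cvgr_dist_lt _ C^o _ _ _ _ _ (kP (D i) (D j)) _ m0).
move=> [n0 _ kn]; exists (k (maxn n0 m)).
  exact: leq_trans (leq_maxr n0 m) (k_ge _).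
move=> i im j jm; have [_ <-] := PE (D i).
exact: (kn (maxn n0 m) (leq_maxl _ _)).
Qed.

(** Three errors of e / 3: from S to a partial sum of the series, from there to rational
    coefficients, and from there to a power of T. *)
Lemma laurent_approx T a S : isometries H T -> (forall y, exists x, T x = y) ->
  (forall p, laurent_recurrent p T) ->
  (\esum_(n in [set: int]) (Normc.normc (a n))%:E <= 1)%E ->
  is_laurent_sum a T S ->
  contractions H S /\ forall m (e : C), 0 < e -> exists2 n, (m <= n)%N &
    forall i, (i < m)%N -> forall j, (j < m)%N ->
    `|inner (S (D i)) (D j) - inner (iter n T (D i)) (D j)| < e.
Proof.
move=> iT sT rT a1 aS.
have a1N N := esum_window_le N a1.
have /choice[P /all_and2[cP PE]] : forall N, exists P : bop H, contractions H P /\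
    forall x, P x = laurent_partial_sum a T N x /\
      forall y, inner (P x) y = laurent_form (fun i => a (i%:Z - N%:Z)) N T x y.
  move=> N; have [P cP PE] := laurent_bop (c := fun i => a (i%:Z - N%:Z)) iT sT (a1N N).
  by exists P; split.
have /(laurent_sumP (T := T) S) [/(_ aS) SP _] :
  forall N x, P N x = laurent_partial_sum a T N x by move=> N x; have [] := PE N x.
have cS : contractions H S.
  move=> x; apply/ler_addgt0Pr => e e0.
  have x1 : 0 < `|x| + 1 by rewrite ltr_wpDl.
  have [N _ /(_ N (leqnn N)) /= SN] := SP _ (divr_gt0 e0 x1).
  rewrite -[S x](subrK (P N x)) addrC; apply: le_trans (ler_normD _ _) _.
  apply: lerD; first exact: cP.
  by apply: le_trans (SN x) _; rewrite mulrAC ler_pdivrMr// ler_pM2l// lerDl.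
split=> // m e e0.
pose K : C := 1 + \sum_(i < m) `|D i|.
have K1 : 1 <= K by rewrite lerDl sumr_ge0.
have K0 : 0 < K by exact: lt_le_trans K1.
have DK i : (i < m)%N -> `|D i| <= K.
  move=> im; rewrite /K (bigD1 (Ordinal im)) //= addrCA lerDl.
  by rewrite addr_ge0// sumr_ge0.
have DDK i j : (i < m)%N -> (j < m)%N -> `|D i| * `|D j| <= K ^+ 2.
  by move=> im jm; rewrite expr2 ler_pM// DK.
(* A relative error d becomes at most e / 3 on a pair of vectors of norm at most K. *)
have [d d0 dK] : exists2 d : C, 0 < d & d * K ^+ 2 = e / 3.
  have KK : 0 < K ^+ 2 by rewrite exprn_gt0.
  by exists (e / 3 / K ^+ 2); rewrite ?divfK ?gt_eqF ?divr_gt0.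
have [N _ /(_ N (leqnn N)) /= SN] := SP _ d0.
have [s s1 sa] := rat_coef_approx (c := fun i => a (i%:Z - N%:Z)) d0 (a1N N).
have e3 : 0 < e / 3 by rewrite divr_gt0.
have [q qe] := near_natSinv_lt e3.
(* Here m accounts for the vectors and the exponent, q for the precision. *)
have [n mn nT] := rT (N, s, maxn m q) s1.
exists n => [|i im j jm]; first exact: leq_trans (leq_maxl _ _) mn.
have h1 : `|inner (S (D i)) (D j) - inner (P N (D i)) (D j)| <= e / 3.
  rewrite -innerBl; apply: (le_trans (inner_le_norm _ _)).
  apply: (le_trans (ler_wpM2r _ (SN _))) => //; rewrite -mulrA -dK.
  by rewrite ler_wpM2l ?(ltW d0)// DDK.
have h2 : `|inner (P N (D i)) (D j) -
    laurent_form (rat_coef s) N T (D i) (D j)| <= e / 3.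
  have [_ ->] := PE N (D i); rewrite laurent_formB.
  apply: (le_trans (laurent_form_le _ _ _ _ iT)).
  by rewrite -dK ler_pM ?sumr_ge0 ?mulr_ge0// DDK.
have h3 : `|laurent_form (rat_coef s) N T (D i) (D j) -
    inner (iter n T (D i)) (D j)| < e / 3.
  apply: lt_trans (qe _ (leq_maxr m q)).
  by apply: nT; apply: leq_trans (leq_maxl _ _).
have -> : e = e / 3 + e / 3 + e / 3 by field.
apply: le_lt_trans (ler_ltD (lerD h1 h2) h3).
rewrite -[X in `|X| <= _](subrKA (inner (P N (D i)) (D j))).
rewrite -[X in `|_ + X| <= _](subrKA (laurent_form (rat_coef s) N T (D i) (D j))).
by rewrite addrA; apply: le_trans (ler_normD _ _) _; rewrite lerD2r ler_normD.
Qed.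

(** Exponents are picked successively so that the coefficients converge on D; contractivity of T and
    S extends the convergence to all vectors. *)
Lemma weak_limits_dense T S : contractions H T -> contractions H S ->
  (forall m (e : C), 0 < e -> exists2 n, (m <= n)%N &
    forall i, (i < m)%N -> forall j, (j < m)%N ->
    `|inner (S (D i)) (D j) - inner (iter n T (D i)) (D j)| < e) ->
  weak_limits T S.
Proof.
move=> cT cS TS.
have /choice[g gP] : forall p : nat * nat, exists n, (p.2 <= n)%N /\
    forall i, (i < p.1)%N -> forall j, (j < p.1)%N ->
    `|inner (S (D i)) (D j) - inner (iter n T (D i)) (D j)| < p.1.+1%:R^-1.
  move=> [m M] /=; have m0 : 0 < m.+1%:R^-1 :> C by rewrite invr_gt0 ltr0n.
  have [n mn nP] := TS (maxn m M) _ m0.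
  exists n; split; first exact: leq_trans (leq_maxr _ _) mn.
  by move=> i im j jm; apply: nP; apply: leq_trans (leq_maxl _ _).
(* The second argument of g forces the next exponent above the previous one. *)
pose k := fix k j := if j is j'.+1 then g (j'.+1, (k j').+1) else g (0, 0)%N.
have k_mono : {homo k : m n / (m < n)%N}.
  apply: homo_ltn; first exact: ltn_trans.
  by move=> i /=; have [] := gP (i.+1, (k i).+1).
have kP m i j : (i < m)%N -> (j < m)%N ->
    `|inner (S (D i)) (D j) - inner (iter (k m) T (D i)) (D j)| < m.+1%:R^-1.
  by move=> im jm; case: m im jm => // m im jm; have [_] := gP (m.+1, (k m).+1); apply.
exists k => //; apply/cvg_WOTP => x y; apply/cvgrPdist_lt => e e0.
have e3 : 0 < e / 3 by rewrite divr_gt0.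
have y2 : 0 < 2 * (`|y| + 1) by rewrite mulr_gt0// ltr_wpDl.
have [i xi] := denseD x (divr_gt0 e3 y2).
(* The approximant of y is chosen after that of x, as its precision depends on the norm of D i. *)
have i2 : 0 < 2 * (`|D i| + 1) by rewrite mulr_gt0// ltr_wpDl.
have [l yl] := denseD y (divr_gt0 e3 i2).
have [q qe] := near_natSinv_lt e3.
have STle n z : `|S z - iter n T z| <= 2 * `|z|.
  apply: (le_trans (ler_normB _ _)); rewrite mulrDl mul1r.
  by apply: lerD; [exact: cS|exact: contraction_iter].
suff : \forall j \near \oo, `|inner (S x) y - inner (iter (k j) T x) y| < e by [].
near=> j.
pose G (z : H) := S z - iter (k j) T z.
have GB u v : G u - G v = G (u - v).
  rewrite /G -[iter _ _ (u - v)]/(bop_pow T (k j) (u - v)) !bopB /=.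
  by rewrite !opprD !opprK addrACA.
rewrite -innerBl -/(G x).
have -> : inner (G x) y =
    inner (G (x - D i)) y + inner (G (D i)) (y - D l) + inner (G (D i)) (D l).
  by rewrite -GB innerBl innerBr addrA subrK subrK.
have -> : e = e / 3 + e / 3 + e / 3 by field.
apply: le_lt_trans (ler_normD _ _) _; apply: ler_ltD; last first.
  rewrite /G innerBl; apply: lt_trans (qe j _); last by near: j; exists q.
  by apply: kP; near: j; [exists i.+1|exists l.+1].
apply: le_trans (ler_normD _ _) _; apply: lerD.
  apply: (le_trans (inner_le_norm _ _)).
  apply: (@le_trans _ _ (2 * `|x - D i| * (`|y| + 1))).
    by rewrite ler_pM// ?lerDl// STle.
  by rewrite mulrAC mulrC -ler_pdivlMr// ltW.
apply: (le_trans (inner_le_norm _ _)).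
apply: (@le_trans _ _ (2 * (`|D i| + 1) * `|y - D l|)).
  rewrite ler_pM//; apply: le_trans (STle _ _) _.
  by rewrite ler_pM2l// lerDl.
by rewrite mulrC -ler_pdivlMr// ltW.
Unshelve. all: by end_near. Qed.

Lemma cauchy_seq_cvg (u : nat -> H) :
  (forall e : C, 0 < e -> exists N, forall n m, (N <= n)%N -> (N <= m)%N ->
    `|u n - u m| < e) -> exists l : H, u @ \oo --> l.
Proof.
move=> uc; have : cauchy (u @ \oo).
  apply/cauchy_ballP => e e0; have [N uN] := uc e e0.
  exists ([set x | exists2 n, (N <= n)%N & x = u n],
          [set x | exists2 n, (N <= n)%N & x = u n]) => /=.
    by split; exists N => // n Nn; exists n.
  by move=> [a b] /= [[n Nn ->] [m Nm ->]]; rewrite -ball_normE /=; exact: uN.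
by move=> /cauchy_cvgP /cvg_ex.
Qed.

(** The range of an isometry is closed: preimages of a convergent sequence form a Cauchy
    sequence. *)
Lemma almost_onto_surjective T : isometries H T -> (forall p, almost_onto p T) ->
  forall y, exists x, T x = y.
Proof.
move=> iT oT y.
have /choice[u uP] : forall n : nat, exists x, `|y - T x| < 2 * n.+1%:R^-1.
  move=> n; have n0 : 0 < n.+1%:R^-1 :> C by rewrite invr_gt0 ltr0n.
  have [i yi] := denseD y n0; have [x Tx] := oT (i, n).
  exists x; rewrite -(subrKA (D i)); apply: (le_lt_trans (ler_normD _ _)).
  by rewrite mulrDl mul1r ltrD.
have uT (e : C) : 0 < e -> exists N, forall n, (N <= n)%N -> `|y - T (u n)| < e.
  move=> e0; have e2 : 0 < e / 2 by rewrite divr_gt0.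
  have [N NP] := near_natSinv_lt e2; exists N => n Nn.
  by apply: (lt_trans (uP n)); rewrite mulrC -ltr_pdivlMr// NP.
have [x ux] : exists x, u @ \oo --> x.
  apply: cauchy_seq_cvg => e e0; have e2 : 0 < e / 2 by rewrite divr_gt0.
  have [N NP] := uT _ e2; exists N => n m Nn Nm.
  rewrite -iT bopB -(subrKA y) (splitr e); apply: (le_lt_trans (ler_normD _ _)).
  by rewrite ltrD// ?NP// distrC NP.
exists x.
have h1 : T (u n) @[n --> \oo] --> T x.
  by apply: continuous_cvg => //; exact: bop_continuous.
have h2 : T (u n) @[n --> \oo] --> y.
  by apply/cvgrPdist_lt => e e0; have [N NP] := uT _ e0; exists N.
exact: (cvg_unique _ h1 h2).
Qed.

Lemma universal_unitariesP T : universal_unitaries H T <->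
  isometries H T /\ forall k, generic_condition k T.
Proof.
split=> [uT|[iT /generic_conditionP[oT rT]]].
  have [/unitariesP[iT sT] _] := uT; split=> //; apply/generic_conditionP; split.
    move=> p; have [y Ty] := sT (D p.1); exists y.
    by rewrite Ty subrr normr0 invr_gt0 ltr0n.
  by move=> p; exact: universal_recurrent.
have sT : forall y, exists x, T x = y.
  exact: almost_onto_surjective.
split; first exact/unitariesP.
move=> S [a a1 aS].
have [cS ST] := laurent_approx iT sT rT a1 aS.
by apply: weak_limits_dense => //; exact: isometries_contractions.
Qed.

(** * Universal unitaries as a countable intersection of weakly open sets *)

Lemma open_SOT (O : set (bop H)) : open (O : set (WOT H)) -> open (O : set (SOT H)).
Proof.
rewrite !openE => oO T OT; have := oO T OT; rewrite /interior => nO.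
have /cvg_SOTP S : nbhs (T : SOT H) --> (T : SOT H) by exact: cvg_id.
have W : nbhs (T : SOT H) --> (T : WOT H).
  by apply/cvg_WOTP => x y; apply: cvg_innerl; exact: S.
exact: W.
Qed.

Lemma open_SOTstar (O : set (bop H)) :
  open (O : set (WOT H)) -> open (O : set (SOTstar H)).
Proof.
rewrite !openE => oO T OT; have := oO T OT; rewrite /interior => nO.
have /cvg_SOTstarP[S _] : nbhs (T : SOTstar H) --> (T : SOTstar H) by exact: cvg_id.
have W : nbhs (T : SOTstar H) --> (T : WOT H).
  by apply/cvg_WOTP => x y; apply: cvg_innerl; exact: S.
exact: W.
Qed.

(* Taking weak interiors loses no point of the set: by [strong_cvg_isometry] the
   strongly open generic conditions are weak neighbourhoods of their isometries. *)
Definition generic_open (k : nat) : set (bop H) :=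
  match unpickle k with
  | Some (inl p) => almost_isometric p
  | Some (inr k) => interior
      ([set T | contractions H T -> generic_condition k T] : set (WOT H))
  | None => setT
  end.

Lemma open_generic_open k : open (generic_open k : set (WOT H)).
Proof.
rewrite /generic_open; case: unpickle => [[p|j]|].
- exact: open_almost_isometric.
- exact: open_interior.
- exact: openT.
Qed.

Lemma universal_unitaries_bigcap :
  universal_unitaries H = contractions H `&` \bigcap_k generic_open k.
Proof.
apply/seteqP; split=> T.
  move=> /universal_unitariesP [iT gT].
  have /isometriesP[cT aT] := iT.
  split=> // k _; rewrite /generic_open; case: unpickle => [[p|j]|//].
    exact: aT.
  rewrite /interior /=.
  have := generic_condition_near (F := within (contractions H) (nbhs (T : WOT H)))
    _ (U := id) _ (strong_cvg_isometry iT) (gT j).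
  move=> h; apply: h; exact: (withinT _ (nbhs_filter (T : WOT H))).
move=> [cT gT]; apply/universal_unitariesP; split.
  apply/isometriesP; split=> // p.
  have := gT (pickle (inl p : nat * nat + nat)) I.
  by rewrite /generic_open pickleK.
move=> k; have := gT (pickle (inr k : nat * nat + nat)) I.
by rewrite /generic_open pickleK => /interior_subset /(_ cT).
Qed.

(** [B] stands for the contractions, where the intersection formula holds, and [A] for any of the
    three spaces inside it. *)
Lemma Gdelta_set_type (X : topologicalType) (A E B : set X) (O : nat -> set X) :
  E `<=` A -> A `<=` B -> E = B `&` \bigcap_k O k -> (forall k, open (O k)) ->
  Gdelta (set_val @^-1` E : set (set_type A)).
Proof.
move=> EA AB EO oO; exists (fun k => set_val @^-1` O k : set (set_type A)).
  move=> k; apply: open_comp; last exact: oO.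
  by move=> x _; exact: initial_continuous.
apply/seteqP; split=> x /=.
  by rewrite EO => -[_ OE] k _; exact: OE.
by move=> Ox; rewrite EO; split; [apply: AB; exact: set_valP|move=> k _; exact: Ox].
Qed.

(** * Baire category in the strong topology *)

(** The inequalities are not strict, so that they pass to strong limits in the Baire argument. *)
Definition strong_base (A : set (bop H)) T (p : seq H * nat) : set (bop H) :=
  [set S | A S /\ forall x, x \in p.1 -> `|S x - T x| <= p.2.+1%:R^-1].

Lemma natSinv_le (m n : nat) : (m <= n)%N -> n.+1%:R^-1 <= m.+1%:R^-1 :> C.
Proof. by move=> mn; rewrite lef_pV2 ?posrE ?ltr0n// ler_nat ltnS. Qed.

Lemma strong_base_filter (A : set (bop H)) T :
  Filter (filter_from setT (strong_base A T)).
Proof.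
apply: filter_from_filter; first by exists ([::], 0%N).
move=> [F m] [G n] _ _; exists (F ++ G, maxn m n) => // S [AS SP].
split; split=> // x xF.
  apply: (le_trans (SP x _)) => /=; first by rewrite mem_cat xF.
  by apply: natSinv_le; exact: leq_maxl.
apply: (le_trans (SP x _)) => /=; first by rewrite mem_cat xF orbT.
by apply: natSinv_le; exact: leq_maxr.
Qed.

Lemma strong_base_cvg (A : set (bop H)) T x :
  (S : bop H) x @[S --> filter_from setT (strong_base A T)] --> T x.
Proof.
have FF := strong_base_filter A T.
apply/cvgrPdistC_le => e e0; have [q /(_ q (leqnn q)) qe] := near_natSinv_lt e0.
exists ([:: x], q) => // S [_ SP] /=.
by apply: le_trans (ltW qe); apply: SP; rewrite mem_head.
Qed.

Lemma generic_condition_open k T : isometries H T -> generic_condition k T ->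
  exists p, strong_base (isometries H) T p `<=` generic_condition k.
Proof.
move=> iT gT; have FF := strong_base_filter (isometries H) T.
have [|p _ pP] := @generic_condition_near _ _ FF id T k _ (@strong_base_cvg _ _) gT.
  by exists ([::], 0%N) => // S [iS _]; exact: isometries_contractions.
by exists p.
Qed.

(* The state (T, (F, n)) stands for the set of isometries that are
   1/(n+1)-close to T on F. As n at least doubles at each step, later
   operators stay within all earlier neighbourhoods. *)
Lemma baire_isometries :
  (forall k T p, isometries H T ->
    (strong_base (isometries H) T p `&` generic_condition k) !=set0) ->
  forall T p, isometries H T ->
    (strong_base (isometries H) T p `&` universal_unitaries H) !=set0.
Proof.
move=> dense_step T0 p0 iT0.
pose step (k : nat) (s t : bop H * (seq H * nat)) := isometries H s.1 ->
  [/\ strong_base (isometries H) s.1 (s.2.1, s.2.2.*2.+1) t.1,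
      {subset s.2.1 <= t.2.1}, D k \in t.2.1, (s.2.2.*2.+1 <= t.2.2)%N &
      strong_base (isometries H) t.1 t.2 `<=` generic_condition k].
have /choice[next nextP] : forall ks, exists t, step ks.1 ks.2 t.
  move=> [k [T [F n]]]; have [iT|niT] := pselect (isometries H T); last first.
    by exists (T, (F, n)) => /niT.
  have [S [ST gS]] := dense_step k T (F, n.*2.+1) iT.
  have [[G m] Gm] := generic_condition_open ST.1 gS.
  (* Including G and m keeps later operators inside condition k; including D k makes the sequence
     converge at every point of D. *)
  exists (S, (D k :: F ++ G, maxn n.*2.+1 m)) => _; split=> //=.
  - by move=> x xF; rewrite inE mem_cat xF orbT.
  - by rewrite mem_head.
  - exact: leq_maxl.
  move=> V [iV VS]; apply: Gm; split=> // x xG.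
  apply: (le_trans (VS x _)) => /=; first by rewrite inE mem_cat xG !orbT.
  by apply: natSinv_le; exact: leq_maxr.
pose s := fix s k := if k is k'.+1 then next (k', s k') else (T0, p0).
pose U k := (s k).1; pose F k := (s k).2.1; pose n k := (s k).2.2.
have iU k : isometries H (U k).
  by elim: k => //= k IHk; have [[]] := nextP (k, s k) IHk.
have sP k : step k (s k) (s k.+1) := nextP (k, s k).
have UP k x : x \in F k -> `|U k.+1 x - U k x| <= (n k).*2.+2%:R^-1.
  by have [[_ h] _ _ _ _] := sP k (iU k); exact: h.
have FP k l : (k <= l)%N -> {subset F k <= F l}.
  elim: l => [|l IHl]; first by rewrite leqn0 => /eqP ->.
  rewrite leq_eqVlt => /predU1P[->//|/IHl kl] x /kl.
  by have [_ h _ _ _] := sP l (iU l); exact: h.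
have DF k l : (k < l)%N -> D k \in F l.
  move=> kl; apply: (FP _ _ kl); by have [_ _ h _ _] := sP k (iU k).
have nS k : ((n k).*2.+1 <= n k.+1)%N by have [_ _ _ h _] := sP k (iU k).
have nk k : (k <= n k)%N.
  elim: k => // k IHk; apply: leq_trans (nS k); rewrite ltnS.
  by apply: (leq_trans IHk); rewrite -addnn leq_addr.
(* The steps telescope: as n (l + 1) >= 2 n l + 1, the step 1/(2 n l + 2) is at most 1/(n l + 1) -
   1/(n (l + 1) + 1). *)
have Ukl k l x : (k <= l)%N -> x \in F k ->
    `|U l x - U k x| <= (n k).+1%:R^-1 - (n l).+1%:R^-1.
  move=> kl xF; elim: l kl => [|l IHl].
    by rewrite leqn0 => /eqP ->; rewrite !subrr normr0.
  rewrite leq_eqVlt => /predU1P[->|kl]; first by rewrite !subrr normr0.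
  rewrite -(subrKA (U l x)); apply: (le_trans (ler_normD _ _)).
  have xFl : x \in F l by exact: FP xF.
  rewrite addrC; apply: (le_trans (lerD (IHl kl) (UP _ _ xFl))).
  rewrite -[X in _ <= X](subrKA (n l).+1%:R^-1) lerD2l.
  have h := natSinv_le (nS l).
  rewrite lerBrDr; apply: (le_trans (lerD (lexx _) h)).
  have -> : (n l).*2.+2%:R = 2 * (n l).+1%:R :> C by rewrite -doubleS -mul2n natrM.
  have : (n l).+1%:R != 0 :> C by rewrite pnatr_eq0.
  by move=> h0; rewrite le_eqVlt; apply/orP; left; apply/eqP; field.
have Ukl' k l x : (k <= l)%N -> x \in F k -> `|U l x - U k x| <= (n k).+1%:R^-1.
  move=> kl xF; apply: (le_trans (Ukl _ _ _ kl xF)).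
  by rewrite lerBlDr lerDl invr_ge0 ler0n.
have /choice[f fP] : forall x, exists y : H, U k x @[k --> \oo] --> y.
  move=> x; apply: cauchy_seq_cvg => e e0.
  have e4 : 0 < e / 4 by rewrite divr_gt0.
  have [i xi] := denseD x e4; have [q qP] := near_natSinv_lt e4.
  pose N := maxn i.+1 q; exists N.
  (* The sequence is controlled at D i, and the isometries carry this over to the nearby x. *)
  have UN k : (N <= k)%N -> `|U k x - U N (D i)| < e / 4 + e / 4.
    move=> Nk; rewrite -(subrKA (U k (D i))); apply: (le_lt_trans (ler_normD _ _)).
    apply: ltrD; first by rewrite -bopB iU.
    apply: (le_lt_trans (Ukl' _ _ _ Nk _)); first by apply: DF; exact: leq_maxl.
    by apply: qP; apply: leq_trans (nk N); exact: leq_maxr.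
  move=> k l Nk Nl; rewrite -(subrKA (U N (D i))).
  have -> : e = (e / 4 + e / 4) + (e / 4 + e / 4) by field.
  apply: (le_lt_trans (ler_normD _ _)); rewrite ltrD ?UN//.
  by rewrite distrC UN.
have [fb nf] : f \in @bounded_operators R H /\ forall x, `|f x| = `|x|.
  by apply: (cvg_norm_isometry _ _ fP); exists 0%N.
pose T := mkbop fb; have iT : isometries H T by [].
have TU k : strong_base (isometries H) (U k) (F k, n k) T.
  split=> // x xF /=; apply/ler_addgt0Pr => e e0.
  have /cvgrPdist_lt /(_ e e0) [N _ NP] := fP x.
  rewrite -(subrKA (U (maxn N k) x)) [_^-1 + e]addrC.
  apply: le_trans (ler_normD _ _) _; apply: lerD.
    by apply: ltW; apply: NP; exact: leq_maxl.
  exact: Ukl' (leq_maxr _ _) xF.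
exists T; split; first exact: (TU 0%N).
apply/universal_unitariesP; split=> // k.
have [_ _ _ _ h] := sP k (iU k); apply: h.
exact: (TU k.+1).
Qed.

(** * Finite-rank diagonal perturbations of the identity *)

Definition orthonormal (I : finType) (f : I -> H) :=
  forall i j, inner (f i) (f j) = (i == j)%:R.

(** For orthonormal f this is the orthogonal projection onto the span, and [fourier_sum f x = x]
    serves as membership in the span. *)
Definition fourier_sum (I : finType) (f : I -> H) x := \sum_i inner x (f i) *: f i.

Lemma orthonormal_norm (I : finType) (f : I -> H) i : orthonormal f -> `|f i| = 1.
Proof.
move=> of_; have := of_ i i; rewrite eqxx innerxx => /eqP.
rewrite sqrf_eq1 => /orP[/eqP//|/eqP E].
by have := normr_ge0 (f i); rewrite E oppr_ge0 ler10.
Qed.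

Lemma inner_lincomb (I : finType) (f : I -> H) (c : I -> C) j : orthonormal f ->
  inner (\sum_i c i *: f i) (f j) = c j.
Proof.
move=> of_; rewrite inner_suml (bigD1 j)//= innerZl of_ eqxx mulr1.
by rewrite big1 ?addr0// => i ij; rewrite innerZl of_ (negPf ij) mulr0.
Qed.

Lemma fourier_sum_inner (I : finType) (f : I -> H) x j : orthonormal f ->
  inner (fourier_sum f x) (f j) = inner x (f j).
Proof. exact: inner_lincomb. Qed.

Lemma fourier_sum_lincomb (I : finType) (f : I -> H) (c : I -> C) : orthonormal f ->
  fourier_sum f (\sum_i c i *: f i) = \sum_i c i *: f i.
Proof. by move=> of_; apply: eq_bigr => i _; rewrite inner_lincomb. Qed.

(** The difference of the two sides is the squared norm of x minus its projection. *)
Lemma bessel (I : finType) (f : I -> H) x : orthonormal f ->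
  \sum_i `|inner x (f i)| ^+ 2 <= `|x| ^+ 2.
Proof.
move=> of_; rewrite -subr_ge0.
have -> : `|x| ^+ 2 - \sum_i `|inner x (f i)| ^+ 2 = `|x - fourier_sum f x| ^+ 2.
  rewrite -!innerxx innerBl !innerBr.
  have h (y : H) : (forall i, inner y (f i) = inner x (f i)) ->
      inner y (fourier_sum f x) = \sum_i `|inner x (f i)| ^+ 2.
    move=> yf; rewrite inner_sumr; apply: eq_bigr => i _.
    by rewrite innerZr yf mulrC -normCK.
  rewrite (h x)// (h (fourier_sum f x)); last by move=> i; exact: fourier_sum_inner.
  set S := \sum_i _; have SR : S^* = S.
    rewrite rmorph_sum; apply: eq_bigr => i _.
    by rewrite rmorphXn /= conj_Creal// normr_real.
  by rewrite (innerC (fourier_sum f x)) (h x)// SR subrr subr0.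
by rewrite exprn_ge0.
Qed.

Lemma orthonormal_option (I : finType) (f : I -> H) x : orthonormal f ->
  x != fourier_sum f x ->
  orthonormal (fun o : option I => if o is Some i then f i else
    `|x - fourier_sum f x|^-1 *: (x - fourier_sum f x)).
Proof.
move=> of_ xf; set y := x - _; have y0 : `|y| != 0 by rewrite normr_eq0 subr_eq0.
have yf i : inner y (f i) = 0 by rewrite innerBl fourier_sum_inner// subrr.
move=> [i|] [j|] /=; first exact: of_.
- by rewrite innerZr innerC yf conjC0 mulr0.
- by rewrite innerZl yf mulr0.
rewrite innerZl innerZr conj_Creal ?rpredV ?normr_real// innerxx expr2.
by rewrite mulKf// mulVf.
Qed.

Lemma big_option_type (V : nmodType) (I : finType) (F : option I -> V) :
  \sum_o F o = F None + \sum_i F (Some i).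
Proof.
rewrite (bigD1 None)//= (reindex_omap Some id) => [|[]//]; congr (_ + _).
by apply: eq_bigl => i; rewrite eqxx.
Qed.

(** The index type grows by [option] only when the new vector lies outside the current span; its
    normalised residual is placed at [None]. *)
Lemma gram_schmidt (s : seq H) : exists (I : finType) (f : I -> H),
  orthonormal f /\ forall x, x \in s -> fourier_sum f x = x.
Proof.
elim: s => [|x s [I [f [of_ fs]]]].
  by exists void, (fun i : void => match i with end); split=> // -[].
have [xE|xf] := eqVneq x (fourier_sum f x).
  by exists I, f; split=> // y; rewrite inE => /predU1P[->|/fs].
exists (option I), (fun o : option I => if o is Some i then f i else
    `|x - fourier_sum f x|^-1 *: (x - fourier_sum f x)).
have og := orthonormal_option of_ xf.
split=> // y; set y' := x - fourier_sum f x.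
have y0 : `|y'| != 0 by rewrite normr_eq0 subr_eq0.
rewrite /fourier_sum big_option_type /= !inE => /predU1P[->|ys].
  have -> : inner x (`|y'|^-1 *: y') = `|y'|.
    rewrite innerZr conj_Creal ?rpredV ?normr_real//.
    have -> : inner x y' = inner y' y'.
      apply/eqP; rewrite -subr_eq0 -innerBl subKr inner_suml big1// => i _.
      by rewrite innerZl (innerC (f i)) innerBl fourier_sum_inner// subrr conjC0 mulr0.
    by rewrite innerxx expr2 mulKf.
  by rewrite scalerA mulfV// scale1r -/(fourier_sum f x) subrK.
rewrite -{1}(fs y ys) /= innerZr /fourier_sum inner_suml big1.
  by rewrite mulr0 scale0r add0r; exact: fs.
move=> i _; rewrite innerZl (innerC (f i)) innerBl.
by rewrite fourier_sum_inner// subrr conjC0 mulr0.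
Qed.

Lemma gram_schmidt_ord (s : seq H) : exists (n : nat) (f : 'I_n -> H),
  orthonormal f /\ forall x, x \in s -> fourier_sum f x = x.
Proof.
have [I [f [of_ fs]]] := gram_schmidt s.
exists #|I|, (f \o enum_val); split=> [i j|x xs].
  by rewrite /= of_ (inj_eq enum_val_inj).
rewrite -[RHS](fs x xs) /fourier_sum.
by rewrite (reindex _ (onW_bij _ (@enum_val_bij I))).
Qed.

Lemma orthogonal_unit_vector (s : seq H) : @infinite_dimensional C H ->
  exists2 y, `|y| = 1 & forall x, x \in s -> inner y x = 0.
Proof.
move=> infH; have [n [f [of_ fs]]] := gram_schmidt_ord s.
have [x xf] : exists x, x != fourier_sum f x.
  apply: contrapT => nx; apply: infH; exists n, f => x.
  exists (fun i => inner x (f i)); apply/eqP; apply: contrapT => xf.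
  by apply: nx; exists x; apply/negP.
have og := orthonormal_option of_ xf.
exists (`|x - fourier_sum f x|^-1 *: (x - fourier_sum f x)).
  exact: (orthonormal_norm None og).
move=> z /fs <-; rewrite inner_sumr big1// => i _.
by rewrite innerZr (og None (Some i)) mulr0.
Qed.

Lemma orthonormal_extend (I : finType) (f : I -> H) (J : finType) :
  @infinite_dimensional C H -> orthonormal f -> exists h : J -> H,
  orthonormal h /\ forall i j, inner (h j) (f i) = 0.
Proof.
move=> infH of_.
have /choice[y yP] : forall s : seq H, exists y, `|y| = 1 /\
    forall x, x \in s -> inner y x = 0.
  by move=> s; have [y y1 ys] := orthogonal_unit_vector s infH; exists y.
(* The list g n holds the first n new vectors, and h n is a unit vector orthogonal to them and to
   f. *)
pose g := fix g n := if n is n'.+1 then y (codom f ++ g n') :: g n' else [::].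
pose h n := y (codom f ++ g n).
have hg m n : (m < n)%N -> h m \in g n.
  elim: n => // n IHn; rewrite ltnS leq_eqVlt inE => /predU1P[->|/IHn ->].
    by rewrite eqxx.
  by rewrite orbT.
have hh m n : (m < n)%N -> inner (h n) (h m) = 0.
  by move=> mn; have [_] := yP (codom f ++ g n); apply; rewrite mem_cat hg// orbT.
exists (fun j => h (enum_rank j)); split=> [i j|i j].
  case: (ltngtP (enum_rank i) (enum_rank j)) => [ij|ij|/val_inj /enum_rank_inj ->].
  - rewrite innerC hh// conjC0; case: eqVneq => // E.
    by rewrite E ltnn in ij.
  - by rewrite hh//; case: eqVneq => // E; rewrite E ltnn in ij.
  by rewrite eqxx innerxx (yP _).1 expr1n.
by have [_] := yP (codom f ++ g (enum_rank j)); apply; rewrite mem_cat codom_f.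
Qed.

(** For orthonormal f this multiplies f i by mu i and is the identity on the orthogonal complement
    of the span. *)
Definition diag_fun (I : finType) (f : I -> H) (mu : I -> C) x :=
  x + \sum_i ((mu i - 1) * inner x (f i)) *: f i.

Lemma diag_fun_bounded (I : finType) (f : I -> H) (mu : I -> C) :
  diag_fun f mu \in @bounded_operators R H.
Proof.
apply: (@bounded_operatorsP _ (1 + \sum_i `|mu i - 1| * (`|f i| * `|f i|))).
  move=> a x y; rewrite /diag_fun scalerDr scaler_sumr addrACA -big_split /=.
  congr (_ + _); apply: eq_bigr => i _.
  by rewrite innerDl innerZl mulrDr scalerDl scalerA mulrCA.
move=> x; rewrite mulrDl mul1r; apply: (le_trans (ler_normD _ _)).
rewrite lerD2l mulr_suml; apply: (le_trans (ler_norm_sum _ _ _)).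
apply: ler_sum => i _; rewrite normrZ normrM -!mulrA ler_wpM2l//.
apply: (le_trans (ler_wpM2r _ (inner_le_norm _ _))) => //.
by rewrite mulrC [X in _ * X]mulrC.
Qed.

Definition diag_op (I : finType) (f : I -> H) (mu : I -> C) : bop H :=
  mkbop (diag_fun_bounded f mu).

Lemma diag_opE (I : finType) (f : I -> H) (mu : I -> C) x :
  diag_op f mu x = x + \sum_i ((mu i - 1) * inner x (f i)) *: f i.
Proof. by []. Qed.

Lemma inner_diag_op (I : finType) (f : I -> H) (mu : I -> C) x j : orthonormal f ->
  inner (diag_op f mu x) (f j) = mu j * inner x (f j).
Proof. by move=> of_; rewrite innerDl inner_lincomb//; ring. Qed.

Lemma diag_op_eigen (I : finType) (f : I -> H) (mu : I -> C) j : orthonormal f ->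
  diag_op f mu (f j) = mu j *: f j.
Proof.
move=> of_; rewrite diag_opE (bigD1 j)//= of_ eqxx mulr1 big1 ?addr0.
  by rewrite scalerBl scale1r addrC subrK.
by move=> i ij; rewrite of_ eq_sym (negPf ij) mulr0 scale0r.
Qed.

Lemma diag_op_comp (I : finType) (f : I -> H) (mu nu : I -> C) x : orthonormal f ->
  diag_op f mu (diag_op f nu x) = diag_op f (fun i => mu i * nu i) x.
Proof.
move=> of_; rewrite [LHS]diag_opE [in LHS]diag_opE [RHS]diag_opE -addrA; congr (_ + _).
rewrite -big_split /=; apply: eq_bigr => i _; rewrite -scalerDl; congr (_ *: _).
by rewrite -diag_opE inner_diag_op//; ring.
Qed.

Lemma diag_op1 (I : finType) (f : I -> H) (mu : I -> C) x :
  (forall i, mu i = 1) -> diag_op f mu x = x.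
Proof.
by move=> mu1; rewrite diag_opE big1 ?addr0// => i _; rewrite mu1 subrr mul0r scale0r.
Qed.

Lemma diag_op_iter (I : finType) (f : I -> H) (mu : I -> C) n x : orthonormal f ->
  iter n (diag_op f mu) x = diag_op f (fun i => mu i ^+ n) x.
Proof.
move=> of_; elim: n => [|n IHn]; first by rewrite diag_op1.
rewrite iterS IHn diag_op_comp//; congr (diag_op f _ x).
by apply/funext => i; rewrite exprS.
Qed.

Lemma diag_op_isometry (I : finType) (f : I -> H) (mu : I -> C) : orthonormal f ->
  (forall i, `|mu i| = 1) -> isometries H (diag_op f mu).
Proof.
move=> of_ mu1 x; apply/eqP; rewrite -(@eqrXn2 _ 2)// -!innerxx; apply/eqP.
rewrite {2}diag_opE innerDr inner_sumr.
under eq_bigr => i _ do rewrite innerZr inner_diag_op//.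
rewrite diag_opE innerDl inner_suml -addrA -[RHS]addr0; congr (_ + _).
rewrite -big_split /= big1// => i _.
rewrite innerZl rmorphM rmorphB rmorph1 /= (innerC (f i) x).
have h : mu i * (mu i)^* = 1 by rewrite -normCK mu1 expr1n.
set a := inner x (f i).
transitivity ((mu i * (mu i)^* - 1) * (a * a^*)); first by ring.
by rewrite h subrr mul0r.
Qed.

Lemma diag_op_onto (I : finType) (f : I -> H) (mu : I -> C) : orthonormal f ->
  (forall i, `|mu i| = 1) -> forall y, exists x, diag_op f mu x = y.
Proof.
move=> of_ mu1 y; exists (diag_op f (fun i => (mu i)^-1) y).
rewrite diag_op_comp// diag_op1// => i; rewrite mulfV// -normr_eq0 mu1.
exact: oner_neq0.
Qed.

Lemma diag_op_cvg (I : finType) (f : I -> H) (mu : nat -> I -> C) (la : I -> C) x :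
  (forall i, mu n i @[n --> \oo] --> (la i : C^o)) ->
  diag_op f (mu n) x @[n --> \oo] --> diag_op f la x.
Proof.
move=> mul; under eq_fun do rewrite diag_opE; rewrite diag_opE.
apply: cvgD; first exact: cvg_cst.
apply: cvg_sum_seq => i; under eq_fun do rewrite -scalerA; rewrite -scalerA.
have h : mu n i - 1 @[n --> \oo] --> (la i - 1 : C^o).
  by apply: (@cvgB _ C^o _ _ _ (fun n => mu n i) (fun=> 1)); [exact: mul|exact: cvg_cst].
exact: (@cvgZr_tmp C H _ _ _ _ _ _ h).
Qed.

(* |s - 1| |s + 1| = |z - 1|, and one of the two roots satisfies |s + 1|^2 >= 2. *)
Lemma unit_sqrt (z : C) : `|z| = 1 ->
  exists s, [/\ s ^+ 2 = z, `|s| = 1 & 2 * `|s - 1| ^+ 2 <= `|z - 1| ^+ 2].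
Proof.
move=> z1; pose t := sqrtC z.
have t2 : t ^+ 2 = z by exact: sqrtCK.
have t1 : `|t| = 1.
  apply/eqP; rewrite -(@eqrXn2 _ 2)// expr1n -normrX t2 z1//.
have tt : t * t^* = 1 by rewrite -normCK t1 expr1n.
have sum4 : `|t - 1| ^+ 2 + `|t + 1| ^+ 2 = 4.
  rewrite !normCK !(rmorphB, rmorphD, rmorph1) /=.
  transitivity (2 * (t * t^*) + 2); first by ring.
  by rewrite tt; ring.
have zE : `|z - 1| ^+ 2 = `|t - 1| ^+ 2 * `|t + 1| ^+ 2.
  by rewrite -exprMn -normrM -t2; congr (`|_| ^+ 2); ring.
have re : `|t - 1| ^+ 2 \is Num.real by rewrite rpredX// normr_real.
have [le2|lt2] := real_leP re (@realn C 2).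
  exists t; split=> //; rewrite zE mulrC ler_wpM2l ?exprn_ge0//.
  move: sum4 => /(canRL (addKr _)) ->; rewrite addrC lerBrDr.
  by rewrite (_ : 4 = 2 + 2 :> C) ?lerD2l//; ring.
exists (- t); split; rewrite ?sqrrN ?normrN//.
rewrite -opprD normrN zE ler_wpM2r ?exprn_ge0//.
exact: ltW.
Qed.

(** Repeated square roots: |u - 1|^2 is at most 4, and [unit_sqrt] halves the bound each time. *)
Lemma unit_root (u : C) (p : nat) : `|u| = 1 ->
  exists z : C, [/\ z ^+ (2 ^ p) = u, `|z| = 1 & `|z - 1| ^+ 2 <= 4 / 2 ^+ p].
Proof.
elim: p u => [|p IHp] u u1.
  exists u; split=> //; rewrite expr0 divr1.
  have -> : 4 = 2 ^+ 2 :> C by ring.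
  rewrite ler_pXn2r ?nnegrE//; apply: (le_trans (ler_normB _ _)).
  by rewrite u1 normr1.
have [z [zu z1 zp]] := IHp u u1; have [s [sz s1 sp]] := unit_sqrt z1.
exists s; split=> //; first by rewrite expnS exprM sz.
rewrite [2 ^+ p.+1]exprS invfM mulrCA ler_pdivlMl//.
exact: le_trans sp zp.
Qed.

(** For w = |w| om with |om| = 1, the numbers |w| + i b and |w| - i b with b^2 = 1 - |w|^2 lie on
    the unit circle and have mean |w|; multiplication by om rotates them to u and v. *)
Lemma disc_midpoint (w : C) : `|w| <= 1 ->
  exists u v : C, [/\ `|u| = 1, `|v| = 1 & (u + v) / 2 = w].
Proof.
move=> w1; have [om o1 wE] : exists2 om : C, `|om| = 1 & w = `|w| * om.
  have [->|w0] := eqVneq w 0; first by exists 1; rewrite ?normr1// normr0 mul0r.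
  exists (w / `|w|); last by rewrite mulrCA mulfV ?mulr1// normr_eq0.
  by rewrite normrM normfV normr_id mulfV// normr_eq0.
pose b := sqrtC (1 - `|w| ^+ 2).
have b0 : 0 <= b by rewrite sqrtC_ge0 subr_ge0 expr_le1.
have b2 : b ^+ 2 = 1 - `|w| ^+ 2 by exact: sqrtCK.
have nrm c : c ^+ 2 = b ^+ 2 -> c \is Num.real -> `| `|w| + 'i * c| = 1.
  move=> c2 cR; apply/eqP; rewrite -(@eqrXn2 _ 2)// expr1n normC2_rect ?normr_real//.
  by rewrite c2 b2 addrC subrK.
exists (om * (`|w| + 'i * b)), (om * (`|w| + 'i * - b)); split.
- by rewrite normrM o1 mul1r nrm// ger0_real.
- by rewrite normrM o1 mul1r nrm ?sqrrN// realN ger0_real.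
- by rewrite [RHS]wE; field.
Qed.

Lemma inner_eq_on_span (I : finType) (f : I -> H) (P Q : bop H) x y :
  (forall i j, inner (P (f i)) (f j) = inner (Q (f i)) (f j)) ->
  fourier_sum f x = x -> fourier_sum f y = y -> inner (P x) y = inner (Q x) y.
Proof.
move=> PQ <- <-; rewrite /fourier_sum !bop_sum !inner_suml; apply: eq_bigr => i _.
rewrite !inner_sumr; apply: eq_bigr => j _.
by rewrite !bopZ !innerZl !innerZr PQ.
Qed.

Lemma eq_on_span (I : finType) (f : I -> H) (P Q : bop H) x :
  (forall i, P (f i) = Q (f i)) -> fourier_sum f x = x -> P x = Q x.
Proof.
move=> PQ <-; rewrite /fourier_sum !bop_sum; apply: eq_bigr => i _.
by rewrite !bopZ PQ.
Qed.

(** Take la times a root of order 2^p of u / la^(2^p) that tends to 1. *)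
Lemma unit_root_seq (u la : C) : `|u| = 1 -> `|la| = 1 ->
  exists mu : nat -> C, [/\ forall p, mu p ^+ (2 ^ p) = u, forall p, `|mu p| = 1 &
    mu @ \oo --> (la : C^o)].
Proof.
move=> u1 la1; have la0 : la != 0 by rewrite -normr_eq0 la1 oner_neq0.
have /choice[z zP] : forall p, exists z : C,
    [/\ z ^+ (2 ^ p) = u / la ^+ (2 ^ p), `|z| = 1 &
    `|z - 1| ^+ 2 <= 4 / 2 ^+ p].
  by move=> p; apply: unit_root; rewrite normrM normfV normrX u1 la1 expr1n invr1 mulr1.
exists (fun p => la * z p); split=> [p|p|].
- by have [zE _ _] := zP p; rewrite exprMn zE mulrC divfK// expf_neq0.
- by have [_ z1 _] := zP p; rewrite normrM la1 z1 mulr1.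
apply/(@cvgrPdist_lt _ C^o) => e e0.
have e4 : 0 < e ^+ 2 / 4 by rewrite divr_gt0 ?exprn_gt0.
have [q qP] := near_natSinv_lt e4.
exists q.+1 => // -[//|p] /= qp.
have -> : la - la * z p.+1 = la * (1 - z p.+1) by ring.
rewrite normrM la1 mul1r distrC -(@ltr_pXn2r _ 2) ?nnegrE ?normr_ge0 ?(ltW e0)//.
have [_ _ h] := zP p.+1; apply: (le_lt_trans h); rewrite -ltr_pdivlMl//.
rewrite mulrC; apply: le_lt_trans (qP p qp).
rewrite lef_pV2 ?posrE ?exprn_gt0// -natrX ler_nat.
exact: ltnW (ltn_expl p.+1 _).
Qed.

(** * Splitting eigenvectors and prescribing a power *)

Section splitting.
Variables (I : finType) (f h : I -> H).
Hypotheses (of_ : orthonormal f) (oh : orthonormal h).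
Hypothesis hf : forall i j, inner (h j) (f i) = 0.

(* [f i] is the balanced combination of the two unit vectors (f i +- h i)/sqrt 2,
   whose eigenvalues can be moved independently of each other. *)
Definition split_family (ib : I * bool) : H :=
  (sqrtC 2)^-1 *: (f ib.1 + (-1) ^+ ib.2 *: h ib.1).

Let r2 : C := (sqrtC 2)^-1.

Let r2r2 : r2 * r2 = 2^-1.
Proof. by rewrite -invfM -expr2 sqrtCK. Qed.

Let r2conj : r2^* = r2.
Proof. by rewrite conj_Creal// ger0_real// invr_ge0 sqrtC_ge0 ler0n. Qed.

Lemma split_family_orthonormal : orthonormal split_family.
Proof.
move=> [i b] [j c]; rewrite /split_family /= innerZl innerZr -/r2 r2conj.
rewrite mulrA r2r2 innerDl !innerDr !innerZl !innerZr hf (innerC (f i) (h j)) hf conjC0.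
rewrite !mulr0 addr0 add0r of_ oh rmorphXn rmorphN1.
rewrite -[(i, b) == (j, c)]/((i == j) && (b == c)).
case: (i == j); last by rewrite !mulr0 addr0 mulr0.
by case: b; case: c;
  rewrite /= ?expr0 ?expr1 !(mulr1, mul1r, mulrN, mulNr, opprK) ?subrr ?mulr0//;
  rewrite -mulr2n mulVf// pnatr_eq0.
Qed.

Lemma split_familyE i : f i = r2 *: (split_family (i, false) + split_family (i, true)).
Proof.
rewrite /split_family /= -/r2 -scalerDr scalerA r2r2 expr0 expr1 scale1r scaleN1r.
rewrite addrACA subrr addr0 -mulr2n -(scaler_nat 2 (f i)) scalerA.
by rewrite mulVf ?scale1r// pnatr_eq0.
Qed.

(** Each f i has weight 1/2 on both of its halves, so the compression to the span of f is diagonal,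
    with the means of the eigenvalues as entries. *)
Lemma inner_split (mu : I * bool -> C) i j :
  inner (diag_op split_family mu (f i)) (f j) =
  (mu (i, false) + mu (i, true)) / 2 * (i == j)%:R.
Proof.
have os := split_family_orthonormal.
rewrite [f i]split_familyE bopZ bopD !diag_op_eigen// [f j]split_familyE.
move: os; move: split_family => s os.
rewrite innerZl innerZr r2conj mulrA r2r2 innerDl !innerDr !innerZl !os.
rewrite !xpair_eqE /= !andbF !andbT !mulr0 addr0 add0r; by field.
Qed.

Lemma diag_split (g : I -> C) i :
  diag_op split_family (fun ib => g ib.1) (f i) = g i *: f i.
Proof.
have os := split_family_orthonormal.
by rewrite split_familyE bopZ bopD !diag_op_eigen//= -scalerDr !scalerA mulrC.
Qed.

End splitting.

Lemma recurrent_approx (I : finType) (f : I -> H) (la : I -> C)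
    (c : nat -> C) (N : nat) :
  @infinite_dimensional C H -> orthonormal f -> (forall i, `|la i| = 1) ->
  \sum_(i < N.*2.+1) `|c i| <= 1 ->
  exists (V : bop H) (U : nat -> bop H), [/\ forall i, V (f i) = la i *: f i,
    forall p, isometries H (U p) /\ (forall y, exists x, U p x = y),
    forall x, U p x @[p --> \oo] --> V x &
    forall p x y, fourier_sum f x = x -> fourier_sum f y = y ->
      inner (iter (2 ^ p) (U p) x) y = laurent_form c N V x y].
Proof.
move=> infH of_ la1 c1; have [h [oh hf]] := orthonormal_extend I infH of_.
have os := split_family_orthonormal of_ oh hf.
pose V := diag_op (split_family f h) (fun ib => la ib.1).
have iV : isometries H V by apply: diag_op_isometry.
have sV : forall y, exists x, V x = y by apply: diag_op_onto.
(* As V (f i) = la i f i, this is the value p(la i). *)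
pose w i := laurent_form c N V (f i) (f i).
have w1 i : `|w i| <= 1.
  apply: (le_trans (laurent_form_le _ _ _ _ iV)).
  by rewrite !(orthonormal_norm i of_) !mulr1.
have /choice[uv uvP] : forall i, exists uv : C * C,
    [/\ `|uv.1| = 1, `|uv.2| = 1 & (uv.1 + uv.2) / 2 = w i].
  by move=> i; have [u [v uv]] := disc_midpoint (w1 i); exists (u, v).
pose u (ib : I * bool) := if ib.2 then (uv ib.1).2 else (uv ib.1).1.
have /choice[mu muP] : forall ib : I * bool, exists mu : nat -> C,
    [/\ forall p, mu p ^+ (2 ^ p) = u ib, forall p, `|mu p| = 1 &
    mu @ \oo --> (la ib.1 : C^o)].
  move=> ib; apply: unit_root_seq => //; rewrite /u.
  by have [u1 v1 _] := uvP ib.1; case: ifP.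
pose U p := diag_op (split_family f h) (mu^~ p).
exists V, U; split=> [i|p|x|p x y xf yf].
- exact: diag_split.
- have mu1 ib : `|mu ib p| = 1 by have [_ ->] := muP ib.
  by split; [exact: diag_op_isometry|exact: diag_op_onto].
- by apply: diag_op_cvg => ib; have [] := muP ib.
have [Q _ QE] := laurent_bop iV sV c1.
have <- := (QE x).2 y; apply: (inner_eq_on_span (P := bop_pow (U p) _) _ xf yf).
move=> i j; rewrite (QE _).2 -[bop_pow _ _ _]/(iter _ _ _) diag_op_iter//.
(* The power of order 2^p has the eigenvalues u, whose means over the two halves are the w i. *)
rewrite (_ : (fun ib => _) = u); last by apply/funext => ib; have [->] := muP ib.
rewrite inner_split//= /u /=; have [_ _ ->] := uvP i.
have [->|ij] := eqVneq i j; first by rewrite mulr1.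
(* Off the diagonal p(V) has zero coefficients too, since the f i are orthogonal eigenvectors of
   V. *)
rewrite mulr0 /laurent_form big1// => k _.
case: (k%:Z - N%:Z) => n /=; rewrite -?iterS diag_op_iter//.
  by rewrite (diag_split of_ oh hf (fun i => la i ^+ n)) innerZl of_ (negPf ij) !mulr0.
by rewrite (diag_split of_ oh hf (fun i => la i ^+ n.+1)) innerZr of_ (negPf ij) !mulr0.
Qed.

(** * Finite matrices: extension of partial isometries and dilation *)

Section matrices.
Local Open Scope sesquilinear_scope.

Definition mx_family (m n : nat) (A : 'M[C]_(m, n)) (b : 'I_n -> H) (i : 'I_m) : H :=
  \sum_j A i j *: b j.

Lemma mx_family_mul (m n p : nat) (A : 'M[C]_(m, n)) (B : 'M[C]_(n, p))
    (b : 'I_p -> H) i :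
  mx_family (A *m B) b i = mx_family A (mx_family B b) i.
Proof.
rewrite /mx_family; under [RHS]eq_bigr => j _ do rewrite scaler_sumr.
rewrite exchange_big /=; apply: eq_bigr => k _; rewrite mxE scaler_suml.
by apply: eq_bigr => j _; rewrite scalerA.
Qed.

Lemma inner_mx_family (m p n : nat) (A : 'M[C]_(m, n)) (B : 'M[C]_(p, n))
    (b : 'I_n -> H) i k : orthonormal b ->
  inner (mx_family A b i) (mx_family B b k) = (A *m B^t*) i k.
Proof.
move=> ob; rewrite inner_sumr mxE; apply: eq_bigr => j _.
by rewrite innerZr inner_lincomb// !mxE mulrC.
Qed.

Lemma mx_family_orthonormal (m n : nat) (A : 'M[C]_(m, n)) (b : 'I_n -> H) :
  orthonormal b -> A \is unitarymx -> orthonormal (mx_family A b).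
Proof.
by move=> ob /unitarymxP AA i j; rewrite inner_mx_family// AA mxE.
Qed.

Definition coord_mx (m n : nat) (e : 'I_m -> H) (b : 'I_n -> H) : 'M[C]_(m, n) :=
  \matrix_(i, j) inner (e i) (b j).

Lemma coord_mx_family (m n : nat) (e : 'I_m -> H) (b : 'I_n -> H) i :
  fourier_sum b (e i) = e i -> mx_family (coord_mx e b) b i = e i.
Proof. by move=> eE; rewrite -[RHS]eE; apply: eq_bigr => j _; rewrite mxE. Qed.

Lemma coord_mx_unitary (m n : nat) (e : 'I_m -> H) (b : 'I_n -> H) :
  orthonormal b -> orthonormal e -> (forall i, fourier_sum b (e i) = e i) ->
  coord_mx e b \is unitarymx.
Proof.
move=> ob oe be; apply/unitarymxP/matrixP => i j.
by rewrite -(inner_mx_family _ _ _ _ ob) !coord_mx_family// oe mxE.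
Qed.

(** For a rectangular matrix, [unitarymx] says that the rows are orthonormal. K is a Gram-Schmidt
    basis of the orthogonal complement of the rows of E, which has dimension n - r. *)
Lemma unitarymx_orthocomplement (r n : nat) (E : 'M[C]_(r, n)) : E \is unitarymx ->
  exists2 K : 'M[C]_(n - r, n), K \is unitarymx & E *m K^t* = 0.
Proof.
move=> uE.
have rE : \rank (orthomx Num.Def.conjC (mx_of_hermitian (hermitian1mx _)) E) =
    (n - r)%N.
  by rewrite rank_ortho mxrank_unitary.
move: rE; set O := orthomx _ _ _ => rE; rewrite -rE.
exists (schmidt (row_base O)); first by rewrite schmidt_unitarymx// rank_leq_col.
apply/orthomx1P.
rewrite orthomx_sym eqmx_schmidt_free ?row_base_free// eq_row_base.
exact: submx_refl.
Qed.

(** Complete E and G to square unitary matrices by rows K and L; then W is the adjoint of the first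
    times the second. *)
Lemma unitarymx_extension (r n : nat) (E G : 'M[C]_(r, n)) :
  E \is unitarymx -> G \is unitarymx ->
  exists2 W : 'M[C]_n, W \is unitarymx & E *m W = G.
Proof.
move=> uE uG.
have [K uK EK] := unitarymx_orthocomplement uE.
have [L uL GL] := unitarymx_orthocomplement uG.
have rn : (r + (n - r) = n)%N by rewrite subnKC// -(mxrank_unitary uE) rank_leq_col.
have cu (A : 'M[C]_(r, n)) (B : 'M[C]_(n - r, n)) : A \is unitarymx ->
    B \is unitarymx -> A *m B^t* = 0 -> col_mx A B \is unitarymx.
  move=> uA uB AB; apply/unitarymxP.
  have BA : B *m A^t* = 0.
    by rewrite -[B]trmxCK -map_mxM -trmx_mul AB trmx0 map_mx0.
  rewrite tr_col_mx map_row_mx mul_col_row AB BA.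
  by rewrite !(unitarymxP _)// -scalar_mx_block.
have u1 := cu _ _ uE uK EK; have u2 := cu _ _ uG uL GL.
have cancel12 : (col_mx E K) *m ((col_mx E K)^t* *m col_mx G L) = col_mx G L.
  by rewrite mulmxA (unitarymxP u1) mul1mx.
exists ((col_mx E K)^t* *m col_mx G L).
  apply/unitarymxP; rewrite trmx_mul map_mxM trmxCK mulmxA mulmxtVK//.
  by have := mulmxKtV 1%:M u1 rn; rewrite mul1mx.
by move: cancel12; rewrite mul_col_mx => /eq_col_mx[].
Qed.

(** Inside the span of e and g, the map from e to g extends to a unitary matrix W; W is normal, and
    the spectral theorem supplies the eigenvectors f and the eigenvalues la. *)
Lemma diag_extension (r : nat) (e g : 'I_r -> H) : orthonormal e -> orthonormal g ->
  exists (n : nat) (f : 'I_n -> H) (la : 'I_n -> C), [/\ orthonormal f,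
    forall i, `|la i| = 1, forall i, fourier_sum f (e i) = e i &
    forall i, diag_op f la (e i) = g i].
Proof.
move=> oe og; have [n [b [ob bs]]] := gram_schmidt_ord (codom e ++ codom g).
have be i : fourier_sum b (e i) = e i by apply: bs; rewrite mem_cat codom_f.
have bg i : fourier_sum b (g i) = g i by apply: bs; rewrite mem_cat codom_f orbT.
have [W uW EW] :=
  unitarymx_extension (coord_mx_unitary ob oe be) (coord_mx_unitary ob og bg).
have WW : W *m W^t* = 1%:M by exact/unitarymxP.
have WW' : W^t* *m W = 1%:M by exact: mulmx1C.
have nW : W \is normalmx by apply/normalmxP; rewrite WW WW'.
have /orthomx_spectralP := nW; set P := spectralmx W; set d := spectral_diag W => WE.
have uP : P \is unitarymx by exact: spectral_unitarymx.
rewrite invmx_unitary// in WE.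
have PP' : P *m P^t* = 1%:M by exact/unitarymxP.
have PP : P^t* *m P = 1%:M by exact: mulmx1C.
have dE : diag_mx d = P *m W *m P^t*.
  by rewrite WE !mulmxA PP' mul1mx -mulmxA PP' mulmx1.
have udiag : diag_mx d \is unitarymx.
  rewrite dE; apply: mul_unitarymx; first exact: mul_unitarymx.
  by rewrite trmxC_unitary.
have d1 i : `|d 0 i| = 1.
  have := unitarymxP udiag; move=> /matrixP /(_ i i).
  rewrite tr_diag_mx map_diag_mx mulmx_diag !mxE eqxx !mulr1n -normCK => /eqP.
  rewrite sqrf_eq1 => /orP[/eqP//|/eqP E].
  by have := normr_ge0 (d 0 i); rewrite E oppr_ge0 ler10.
have of_ := mx_family_orthonormal ob uP.
pose A := coord_mx e b *m P^t*.
have eA i : e i = mx_family A (mx_family P b) i.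
  by rewrite -mx_family_mul -mulmxA PP mulmx1 coord_mx_family.
exists n, (mx_family P b), (fun i => d 0 i); split=> // i.
  by rewrite eA fourier_sum_lincomb.
rewrite eA bop_sum -[RHS](coord_mx_family (bg i)) -EW WE !mulmxA -/A mx_family_mul.
apply: eq_bigr => j _; rewrite bopZ diag_op_eigen// scalerA.
by congr (_ *: _); rewrite mul_mx_diag [RHS]mxE.
Qed.

(* With A the matrix of the compression of T and h orthonormal and orthogonal
   to e, take g = A e + sqrt(1 - A A^* ) h. *)
Lemma contraction_dilation (r : nat) (e : 'I_r -> H) T : @infinite_dimensional C H ->
  contractions H T -> orthonormal e ->
  exists2 g : 'I_r -> H, orthonormal g &
    forall i j, inner (g i) (e j) = inner (T (e i)) (e j).
Proof.
move=> infH cT oe.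
pose A : 'M[C]_r := \matrix_(i, j) inner (T (e i)) (e j).
have hermM : 1%:M - A *m A^t* \is hermsymmx.
  apply/is_hermitianmxP; rewrite expr0 scale1r linearB /= map_mxB trmx_mul map_mxM.
  by rewrite trmx1 map_mx1 map_trmx trmxK -map_mx_comp (eq_map_mx_id _ (@conjCK _)).
have /orthomx_spectralP := hermitian_normalmx hermM.
set P := spectralmx _; set d := spectral_diag _ => ME.
have uP : P \is unitarymx by exact: spectral_unitarymx.
rewrite invmx_unitary// in ME.
have PP' : P *m P^t* = 1%:M by exact/unitarymxP.
have PP : P^t* *m P = 1%:M by exact: mulmx1C.
have dE : diag_mx d = 1%:M - (P *m A) *m (P *m A)^t*.
  rewrite trmx_mul map_mxM -{1}PP' !mulmxA -mulmxBl.
  rewrite -[X in X - _](mulmx1 P) -[_ *m _ *m A^t*]mulmxA -mulmxBr ME.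
  by rewrite !mulmxA PP' mul1mx -mulmxA PP' mulmx1.
(* Row i of P A lists the coefficients along e of T u for the unit vector u = [mx_family P e i]; by
   Bessel its squared norm is at most 1. *)
have d0 i : 0 <= d 0 i.
  have -> : d 0 i = diag_mx d i i by rewrite mxE eqxx.
  rewrite dE !mxE eqxx subr_ge0.
  have oPe := mx_family_orthonormal oe uP.
  have PA j : (P *m A) i j = inner (T (mx_family P e i)) (e j).
    rewrite bop_sum inner_suml mxE; apply: eq_bigr => k _.
    by rewrite bopZ innerZl mxE.
  have tr (Q : 'M[C]_r) j : (Q^t*) j i = (Q i j)^* by rewrite !mxE.
  under eq_bigr => j _ do rewrite tr -normCK PA.
  apply: (le_trans (bessel _ oe)).
  apply: (@le_trans _ _ (`|mx_family P e i| ^+ 2)).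
    by rewrite ler_pXn2r ?nnegrE ?cT.
  by rewrite (orthonormal_norm i oPe) expr1n.
have [h [oh hf]] := orthonormal_extend 'I_r infH oe.
(* B need not be the hermitian square root: only its product with its adjoint enters below. *)
pose B := P^t* *m diag_mx (\row_j sqrtC (d 0 j)).
have BB : A *m A^t* + B *m B^t* = 1%:M.
  have -> : B *m B^t* = 1%:M - A *m A^t*.
    rewrite /B trmx_mul map_mxM trmxCK mulmxA -[X in X *m P]mulmxA.
    rewrite tr_diag_mx map_diag_mx mulmx_diag ME; congr (_ *m diag_mx _ *m _).
    apply/rowP => j; rewrite !mxE.
    transitivity (sqrtC (d 0 j) * (sqrtC (d 0 j))^*%R) => //.
    by rewrite conj_Creal ?ger0_real ?sqrtC_ge0// -expr2 sqrtCK.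
  by rewrite addrC subrK.
have he i j : inner (mx_family B h i) (mx_family A e j) = 0.
  rewrite inner_suml big1// => k _; rewrite inner_sumr big1// => l _.
  by rewrite innerZl innerZr hf !mulr0.
exists (fun i => mx_family A e i + mx_family B h i) => i j.
  rewrite innerDl !innerDr he (innerC (mx_family A e i) (mx_family B h j)) he.
  rewrite conjC0 addr0 add0r.
  rewrite !inner_mx_family//; have /matrixP /(_ i j) := BB.
  by rewrite [X in X = _]mxE [X in _ = X]mxE.
rewrite innerDl inner_lincomb// inner_suml big1; first by rewrite addr0 mxE.
by move=> k _; rewrite innerZl hf mulr0.
Qed.

End matrices.

(** * Density of a single condition among the isometries *)

Lemma near_forall_mem (X : Type) (F : set_system X) (FF : Filter F)
    (s : seq H) (P : H -> X -> Prop) :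
  (forall x, x \in s -> \forall t \near F, P x t) ->
  \forall t \near F, forall x, x \in s -> P x t.
Proof.
move=> sP; have h : \forall t \near F, forall i, (i < size s)%N -> P (nth 0 s i) t.
  by apply: near_forall_ltn => i si; apply: sP; exact: mem_nth.
apply: filterS h => t ht x xs.
by rewrite -(nth_index 0 xs); apply: ht; rewrite index_mem.
Qed.

Lemma fourier_sum_span (I J : finType) (e : I -> H) (f : J -> H) x :
  (forall i, fourier_sum f (e i) = e i) -> fourier_sum e x = x -> fourier_sum f x = x.
Proof.
move=> fe ex; rewrite -{2}ex -{1}ex {1}/fourier_sum.
under eq_bigr => j _ do rewrite inner_suml scaler_suml.
rewrite exchange_big /=; apply: eq_bigr => i _.
rewrite -[X in _ = _ *: X](fe i) scaler_sumr; apply: eq_bigr => j _.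
by rewrite innerZl scalerA.
Qed.

(** The span of F and of the first m vectors of D is where T is replaced by a diagonal unitary; V
    equals T there, and U k tends strongly to V. *)
Lemma dense_recurrent N s m T p : @infinite_dimensional C H -> isometries H T ->
  \sum_(i < N.*2.+1) `|rat_coef s i| <= 1 ->
  exists S, [/\ strong_base (isometries H) T p S, forall y, exists x, S x = y &
    laurent_recurrent (N, s, m) S].
Proof.
move=> infH iT s1; case: p => F n.
have [r [e [oe eL]]] := gram_schmidt_ord (F ++ [seq D i | i <- iota 0 m]).
have oTe : orthonormal (T \o e) by move=> i j; rewrite /= isometry_inner.
have [q [f [la [of_ la1 fe fla]]]] := diag_extension oe oTe.
have [V [U [Vf iU UV UE]]] := recurrent_approx infH of_ la1 s1.
have VT x : fourier_sum e x = x -> V x = T x.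
  apply: eq_on_span => i; rewrite -[T (e i)]/((T \o e) i) -(fla i).
  by apply: (eq_on_span (f := f)) => // j; rewrite Vf diag_op_eigen.
have fD i : (i < m)%N -> fourier_sum f (D i) = D i.
  move=> im; apply: (fourier_sum_span fe); apply: eL; rewrite mem_cat orbC.
  by rewrite map_f// mem_iota add0n.
have near1 : \forall k \near \oo, forall x, x \in F -> `|U k x - T x| <= n.+1%:R^-1.
  apply: near_forall_mem => x xF; rewrite -VT; last by apply: eL; rewrite mem_cat xF.
  by apply: cvgr_distC_le; [exact: UV|rewrite invr_gt0 ltr0n].
have m0 : 0 < m.+1%:R^-1 :> C by rewrite invr_gt0 ltr0n.
have near2 : \forall k \near \oo, forall i, (i < m)%N -> forall j, (j < m)%N ->
    `|laurent_form (rat_coef s) N (U k) (D i) (D j) -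
      laurent_form (rat_coef s) N V (D i) (D j)| < m.+1%:R^-1.
  apply: near_forall_ltn => i _; apply: near_forall_ltn => j _.
  apply: (@cvgr_distC_lt _ C^o) m0; apply: cvg_laurent_form => //.
  by exists 0%N => // k _; apply: isometries_contractions; have [] := iU k.
have [k [k1 k2 mk]] : exists k, [/\ forall x, x \in F -> `|U k x - T x| <= n.+1%:R^-1,
    forall i, (i < m)%N -> forall j, (j < m)%N ->
    `|laurent_form (rat_coef s) N (U k) (D i) (D j) -
      laurent_form (rat_coef s) N V (D i) (D j)| < m.+1%:R^-1 & (m <= k)%N].
  have [a _ ha] := near1; have [b _ hb] := near2.
  exists (maxn a (maxn b m)); split.
  - by apply: ha; exact: leq_maxl.
  - by apply: hb; rewrite /= leq_max leq_maxl orbT.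
  - by rewrite !leq_max leqnn !orbT.
have [iUk sUk] := iU k; exists (U k); split=> // _.
exists (2 ^ k)%N => [|i im j jm].
  by apply: (leq_trans mk); apply: ltnW; exact: ltn_expl.
(* The power of U k has exactly the coefficients of p(V), so only the distance from p(U k) to p(V)
   remains. *)
by rewrite UE ?fD//; exact: k2.
Qed.

Lemma dense_generic_condition k T p : @infinite_dimensional C H -> isometries H T ->
  (strong_base (isometries H) T p `&` generic_condition k) !=set0.
Proof.
move=> infH iT; rewrite /generic_condition.
have TT : strong_base (isometries H) T p T.
  by split=> // x _; rewrite subrr normr0 invr_ge0 ler0n.
case: unpickle => [[a|[[N s] m]]|]; last by exists T.
  (* The zero polynomial suffices here: only the surjectivity of the nearby isometry is wanted. *)
  have c0 : \sum_(i < 0.*2.+1) `|rat_coef [::] i| <= 1.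
    by rewrite big_ord_recl big_ord0 /rat_coef /rat_complex /= !raddf0 addr0 normr0.
  have [S [ST sS _]] := dense_recurrent 0 p infH iT c0.
  exists S; split=> //=; have [y Sy] := sS (D a.1); exists y.
  by rewrite Sy subrr normr0 invr_gt0 ltr0n.
have [s1|/negP s1] := boolP (\sum_(i < N.*2.+1) `|rat_coef s i| <= 1).
  by have [S [ST _ gS]] := dense_recurrent m p infH iT s1; exists S.
by exists T; split.
Qed.

Lemma dense_universal T p : @infinite_dimensional C H -> isometries H T ->
  (strong_base (isometries H) T p `&` universal_unitaries H) !=set0.
Proof.
by move=> infH; apply: baire_isometries => k S q iS; exact: dense_generic_condition.
Qed.

(** * Density *)

Lemma dense_set_type (X : topologicalType) (A E : set X) : E `<=` A ->
  (forall B, open B -> (A `&` B) !=set0 -> (B `&` E) !=set0) ->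
  dense (set_val @^-1` E : set (set_type A)).
Proof.
move=> EA AE O [x Ox] [B oB BO].
have [|y [By Ey]] := AE B oB.
  by exists (set_val x); split; [exact: set_valP|rewrite -BO in Ox].
have Ay : y \in A by rewrite inE; exact: EA.
by exists (exist _ y Ay); split=> //; rewrite -BO.
Qed.

Lemma dense_SOT (B : set (bop H)) : @infinite_dimensional C H ->
  open (B : set (SOT H)) -> (isometries H `&` B) !=set0 ->
  (B `&` universal_unitaries H) !=set0.
Proof.
move=> infH oB [T [iT BT]].
have FF := strong_base_filter (universal_unitaries H) T.
have GT : filter_from setT (strong_base (universal_unitaries H) T) --> (T : SOT H).
  by apply/cvg_SOTP => x; exact: strong_base_cvg.
have [p _ pB] := GT B (open_nbhs_nbhs (conj oB BT)).
have [S [[_ Sp] uS]] := dense_universal p infH iT.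
by exists S; split=> //; apply: pB.
Qed.

(** Among unitaries strong convergence implies convergence of the adjoints: with x = T y, the
    vectors S^-1 x and T^-1 x are as far apart as T y and S y. *)
Lemma dense_SOTstar (B : set (bop H)) : @infinite_dimensional C H ->
  open (B : set (SOTstar H)) -> (unitaries H `&` B) !=set0 ->
  (B `&` universal_unitaries H) !=set0.
Proof.
move=> infH oB [T [uT BT]]; have [iT sT] := (unitariesP T).1 uT.
have FF := strong_base_filter (universal_unitaries H) T.
have GT : filter_from setT (strong_base (universal_unitaries H) T) --> (T : SOTstar H).
  apply/cvg_SOTstarP; split=> x; first exact: strong_base_cvg.
  have [y yx] := sT x.
  have [V [TV VT]] := surjective_isometry_inverse iT sT.
  apply/cvgrPdist_le => e e0.
  have /cvgrPdist_le /(_ e e0) := @strong_base_cvg (universal_unitaries H) T y.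
  move=> [p _ pP]; exists p => // S Sp; have [[/unitariesP[iS sS] _] _] := Sp.
  have [W [SW WS]] := surjective_isometry_inverse iS sS.
  rewrite (adjoint_inverse iT VT) (adjoint_inverse iS WS) -iS bopB WS -yx TV distrC.
  exact: pP.
have [p _ pB] := GT B (open_nbhs_nbhs (conj oB BT)).
have [S [[_ Sp] uS]] := dense_universal p infH iT.
by exists S; split=> //; apply: pB.
Qed.

Definition weak_base T (p : seq H * nat) : set (bop H) :=
  [set S | isometries H S /\ forall x y, x \in p.1 -> y \in p.1 ->
    `|inner (S x) y - inner (T x) y| <= p.2.+1%:R^-1].

Lemma weak_base_filter T : Filter (filter_from setT (weak_base T)).
Proof.
apply: filter_from_filter; first by exists ([::], 0%N).
move=> [F m] [G n] _ _; exists (F ++ G, maxn m n) => // S [AS SP].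
split; split=> // x y xF yF.
  apply: (le_trans (SP x y _ _)) => /=; rewrite ?mem_cat ?xF ?yF//.
  by apply: natSinv_le; exact: leq_maxl.
apply: (le_trans (SP x y _ _)) => /=; rewrite ?mem_cat ?xF ?yF ?orbT//.
by apply: natSinv_le; exact: leq_maxr.
Qed.

(** The dilation gives g with the coefficients of T e along e, and a diagonal isometry sends e to
    g. *)
Lemma weak_base_nonempty T p : @infinite_dimensional C H -> contractions H T ->
  weak_base T p !=set0.
Proof.
case: p => F n infH cT; have [r [e [oe eF]]] := gram_schmidt_ord F.
have [g og gT] := contraction_dilation infH cT oe.
have [q [f [la [of_ la1 fe fg]]]] := diag_extension oe og.
exists (diag_op f la); split; first exact: diag_op_isometry.
move=> x y xF yF; rewrite (inner_eq_on_span (Q := T) _ (eF x xF) (eF y yF)).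
  by rewrite subrr normr0 invr_ge0 ler0n.
by move=> i j; rewrite fg gT.
Qed.

(** Isometries are weakly dense among contractions, and a weakly open set is strongly open, so the
    strong density finishes. *)
Lemma dense_WOT (B : set (bop H)) : @infinite_dimensional C H ->
  open (B : set (WOT H)) -> (contractions H `&` B) !=set0 ->
  (B `&` universal_unitaries H) !=set0.
Proof.
move=> infH oB [T [cT BT]].
have FF := weak_base_filter T.
have GT : filter_from setT (weak_base T) --> (T : WOT H).
  apply/cvg_WOTP => x y; apply/(@cvgrPdistC_le _ C^o) => e e0.
  have [q /(_ q (leqnn q)) qe] := near_natSinv_lt e0.
  exists ([:: x; y], q) => // S [_ SP] /=.
  by apply: le_trans (ltW qe); apply: SP; rewrite !inE eqxx ?orbT.
have [p _ pB] := GT B (open_nbhs_nbhs (conj oB BT)).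
have [S Sp] := weak_base_nonempty p infH cT.
apply: dense_SOT => //; first exact: open_SOT.
by exists S; split; [case: Sp|exact: pB].
Qed.

End countable_conditions.

Lemma separable_dense_seq : separable H ->
  exists D : nat -> H, forall x (e : C), 0 < e -> exists i, `|x - D i| < e.
Proof.
move=> [A /countable_injP[f inj_f] dA].
(* An index outside the image of f yields the default 0, a harmless extra point. *)
pose D n := xget 0 [set x | A x /\ f x = n].
exists D => x e e0.
have oB : open (ball x e) by exact: ball_open.
have [y [xy Ay]] := dA (ball x e) (ex_intro _ x (ballxx x e0)) oB.
exists (f y); have : [set z | A z /\ f z = f y] (D (f y)).
  by apply: xgetPex; exists y.
move=> [AD Df]; have -> : D (f y) = y by apply: inj_f; rewrite ?inE.
by move: xy; rewrite -ball_normE.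
Qed.

End hilbert_space.

Theorem corollary7p4 (R : realType) (H : hilbertType R)
    (Hsep : separable H)
    (Hinf : @infinite_dimensional R[i] H) :
  [/\ @dense_Gdelta_in (SOTstar H) (unitaries H) (universal_unitaries H),
      @dense_Gdelta_in (SOT H) (isometries H) (universal_unitaries H) &
      @comeager_in (WOT H) (contractions H) (universal_unitaries H)].
Proof.
have [D denseD] := separable_dense_seq Hsep.
have UE := universal_unitaries_bigcap denseD.
have EU : universal_unitaries H `<=` unitaries H by move=> T [].
have UI := @unitaries_isometries R H; have IC := @isometries_contractions R H.
have EI := subset_trans EU UI; have EC := subset_trans EI IC.
have UC := subset_trans UI IC.
have oO := open_generic_open D.
split.
- split=> //; first by apply: dense_set_type => // B; exact: (dense_SOTstar denseD).
  apply: (@Gdelta_set_type (SOTstar H) _ _ _ _ EU UC UE) => k; exact: open_SOTstar.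
- split=> //; first by apply: dense_set_type => // B; exact: (dense_SOT denseD).
  apply: (@Gdelta_set_type (SOT H) _ _ _ _ EI IC UE) => k; exact: open_SOT.
(* The universal unitaries themselves are the dense G_delta set. *)
split=> //; exists (universal_unitaries H) => //.
split=> //; first by apply: dense_set_type => // B; exact: (dense_WOT denseD).
exact: (@Gdelta_set_type (WOT H) _ _ _ _ EC (@subset_refl _ _) UE).
Qed.
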